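(* Let $(M,g)$ be a $7$-dimensional oriented Riemannian spin manifold and let $\varphi$ be a unit spinor field on $M$, defining a $G_2$-structure, and let $S\in\mathrm{End}(TM)$ be the endomorphism with $\nabla^g_X\varphi=S(X)\cdot\varphi$ for all $X\in TM$. Then the $G_2$-structure is harmonic if and only if $\mathrm{div}\,S=0$.
   Context: Spinors: $\Delta=\mathbb R^8$ is the real spin representation of $\mathrm{Spin}(7)$ (obtained from a fixed irreducible real Clifford module with $X\cdot X=-|X|^2$, with an inner product for which unit vectors act orthogonally). $S(M)$ is the associated real spinor bundle of a fixed spin structure, and $\nabla^g$ is the Levi-Civita connection and the connection it induces on $S(M)$. For a unit spinor $\varphi$ there is an orthogonal decomposition $\Delta=\mathrm{span}\{\varphi\}\oplus\{X\cdot\varphi\mid X\in\mathbb R^7\}$. Hence for a unit spinor field $\varphi$ there is a unique $S\in\mathrm{End}(TM)$ with $\nabla^g_X\varphi=S(X)\cdot\varphi$. The divergence is the vector field $\mathrm{div}\,S=\sum_i(\nabla^g_{e_i}S)(e_i)$ (local orthonormal frame $(e_i)$). $G_2$-structure and harmonicity: the stabilizer of a unit spinor in $\mathrm{Spin}(7)$ maps isomorphically onto a subgroup $G_2\subset SO(7)$, so $\varphi$ defines a reduction $P\subset SO(M)$ to $G=G_2$. With $\mathfrak{so}(7)=\mathfrak{g}\oplus\mathfrak m$ ($\mathfrak g=\mathfrak g_2$, $\mathfrak m=\mathfrak g_2^\perp$), the $\mathfrak g$-component of the Levi-Civita connection form restricted to $P$ defines a connection $\nabla^G$, and the intrinsic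 torsion is $\xi_XY=\nabla^G_XY-\nabla^g_XY$. The structure is called harmonic if $L:=\sum_i(\nabla^g_{e_i}\xi)_{e_i}=0$ (also when $M$ is non-compact). *)

(* Defs.v *)
From HB Require Import structures.
From mathcomp Require Import all_boot all_order all_algebra.
From mathcomp Require Import all_classical all_reals all_analysis.

Set Implicit Arguments.
Unset Strict Implicit.
Unset Printing Implicit Defensive.

Import Order.TTheory GRing.Theory Num.Theory.
Import numFieldNormedType.Exports.

Local Open Scope classical_set_scope.
Local Open Scope ring_scope.

(* Vectors are columns, so that a frame (e_1, ..., e_7) of a tangent space is  *)
(* the 7 x 7 matrix with columns e_j and SO(7) acts on frames from the right.  *)
Notation vec7 R := 'cV[R]_7 (only parsing).
Notation spinor R := 'cV[R]_8 (only parsing).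

Section Algebra.
Context (R : realType).

Definition dot (n : nat) (u v : 'cV[R]_n) : R := \sum_i u i 0 * v i 0.

Definition basis7 (i : 'I_7) : vec7 R := delta_mx i 0.

(* Real irreducible Clifford modules of R^7 have dimension 8, and after the    *)
(* choice of an orthonormal basis the inner product is the standard one of R^8.*)
Record clifford_module (c : {linear vec7 R -> 'M[R]_8}) : Prop := {
  clifford_sqr : forall X, c X *m c X = (- dot X X)%:M;
  clifford_orth : forall X a b, dot X X = 1 ->
    dot (c X *m a) (c X *m b) = dot a b;
  clifford_irr : forall W : 'M[R]_8, (forall X, stablemx W (c X)^T) ->
    W = 0 \/ row_full W
}.

Definition so7 : set 'M[R]_7 := [set A | A^T = - A].

Context (c : {linear vec7 R -> 'M[R]_8}).

(* Spin(7), realised through its (faithful) spin representation. *)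
Definition Spin7 : set 'M[R]_8 := [set h | exists2 s : seq (vec7 R),
  (forall X, X \in s -> dot X X = 1) /\ ~~ odd (size s) &
  h = \prod_(X <- s) c X].

(* lambda(h) = A for the covering lambda : Spin(7) -> SO(7), i.e.              *)
(* h c(X) h^-1 = c(A X) for all X.                                             *)
Definition spin_covers (h : 'M[R]_8) (A : 'M[R]_7) : Prop :=
  Spin7 h /\ forall X, h *m c X = c (A *m X) *m h.

Definition G2 (phi0 : spinor R) : set 'M[R]_7 :=
  [set A | exists2 h, spin_covers h A & h *m phi0 = phi0].

(* The Lie algebra of the closed subgroup G2 of GL(7): velocities at the       *)
(* identity of curves in G2 (differentiability at 0 suffices as G2 is closed). *)
Definition lie_g2 (phi0 : spinor R) : set 'M[R]_7 := [set A |
  exists2 gam : R -> 'M[R]_7, (forall t, G2 phi0 (gam t)) /\ gam 0 = 1%:M &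
    is_derive (0 : R) (1 : R) gam A].

(* The orthogonal complement is the same for every invariant inner product of  *)
(* so(7), since these are all multiples of the trace form.                     *)
Definition m_g2 (phi0 : spinor R) : set 'M[R]_7 :=
  so7 `&` [set B | forall A, lie_g2 phi0 A -> \tr (A^T *m B) = 0].

Definition g2_component (phi0 : spinor R) (A B : 'M[R]_7) : Prop :=
  lie_g2 phi0 B /\ m_g2 phi0 (A - B).

End Algebra.

Section Smooth.
Context (R : realType) (V : normedModType R).

Fixpoint Ck (k : nat) (U : set (vec7 R)) (f : vec7 R -> V) : Prop :=
  if k is k'.+1 then
    (forall p, U p -> differentiable f p) /\
    (forall v, Ck k' U (fun p => 'D_v f p))
  else forall p, U p -> {for p, continuous f}.

(* U is meant to be open; the values of f outside U are irrelevant. *)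
Definition smooth (U : set (vec7 R)) (f : vec7 R -> V) : Prop :=
  forall k, Ck k U f.

End Smooth.

(* An oriented smooth 7-manifold, given by an oriented smooth atlas which is   *)
(* indexed by the points of M: chart x is defined on the open neighbourhood    *)
(* chart_dom x of x. The tangent space at x is R^7, a tangent vector at x being*)
(* identified with its coordinates in chart x.                                 *)
Record manifold (R : realType) := Manifold {
  mspace :> topologicalType;
  chart_dom : mspace -> set mspace;
  chart : mspace -> mspace -> vec7 R;
  chart_inv : mspace -> vec7 R -> mspace;
  m_hausdorff : hausdorff_space mspace;
  m_second_countable : @second_countable mspace;
  chart_dom_open : forall x, open (chart_dom x);
  chart_dom_mem : forall x, chart_dom x x;
  chart_open : forall x, open (chart x @` chart_dom x);
  chartK : forall x y, chart_dom x y -> chart_inv x (chart x y) = y;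
  chart_continuous : forall x y, chart_dom x y -> {for y, continuous (chart x)};
  chart_inv_continuous : forall x p, (chart x @` chart_dom x) p ->
    {for p, continuous (chart_inv x)};
  chart_smooth : forall x y,
    smooth (chart x @` (chart_dom x `&` chart_dom y)) (chart y \o chart_inv x);
  chart_oriented : forall x y z, chart_dom x z -> chart_dom y z ->
    0 < \det (\matrix_(i, j)
      ('D_(basis7 R j) (chart y \o chart_inv x) (chart x z)) i 0)
}.

Section Calculus.
Context (R : realType) (M : manifold R).

Definition msmooth (V : normedModType R) (U : set M) (f : M -> V) : Prop :=
  forall a : M, smooth (chart a @` (U `&` chart_dom a)) (f \o chart_inv a).

(* The derivative of f at x in the direction of the tangent vector v. *)
Definition mderiv (V : normedModType R) (f : M -> V) (x : M) (v : vec7 R) : V :=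
  'D_v (f \o chart_inv x) (chart x x).

(* X is a smooth vector field on the open set U: its components in every chart *)
(* are smooth.                                                                 *)
Definition vfield (U : set M) (X : M -> vec7 R) : Prop :=
  forall a : M, msmooth (U `&` chart_dom a) (fun y => mderiv (chart a) y (X y)).

(* A smooth section of End(TM); at every point it acts on the coordinates of   *)
(* tangent vectors.                                                            *)
Definition endo_field (S : M -> 'M[R]_7) : Prop :=
  forall U X, open U -> vfield U X -> vfield U (fun y => S y *m X y).

Record metric := Metric {
  gval :> M -> vec7 R -> vec7 R -> R;
  g_sym : forall x v w, gval x v w = gval x w v;
  g_lin : forall x (a : R) u v w,
    gval x (a *: u + v) w = a * gval x u w + gval x v w;
  g_pos : forall x v, v != 0 -> 0 < gval x v v;
  g_smooth : forall U X Y, open U -> vfield U X -> vfield U Y ->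
    msmooth U (fun x => gval x (X x) (Y x))
}.

(* A covariant derivative on TM: nabla x v Y is the derivative at x of the     *)
(* vector field Y in the direction v. It is considered on vector fields that   *)
(* are smooth on some open neighbourhood of x; by the Leibniz rule it depends  *)
(* only on the germ of Y at x.                                                 *)
Definition cov_deriv := M -> vec7 R -> (M -> vec7 R) -> vec7 R.

Record connection (nabla : cov_deriv) : Prop := {
  nabla_lin : forall (U : set M) Y x (a : R) v w, open U -> vfield U Y -> U x ->
    nabla x (a *: v + w) Y = a *: nabla x v Y + nabla x w Y;
  nabla_add : forall (U : set M) Y Z x v, open U -> vfield U Y -> vfield U Z ->
    U x -> nabla x v (fun y => Y y + Z y) = nabla x v Y + nabla x v Z;
  nabla_leibniz : forall (U : set M) (f : M -> R) Y x v, open U ->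
    msmooth U f -> vfield U Y -> U x ->
    nabla x v (fun y => f y *: Y y) = mderiv f x v *: Y x + f x *: nabla x v Y;
  nabla_smooth : forall (U : set M) X Y, open U -> vfield U X -> vfield U Y ->
    vfield U (fun x => nabla x (X x) Y)
}.

Definition metric_compatible (g : metric) (nabla : cov_deriv) : Prop :=
  forall (U : set M) Y Z x v, open U -> vfield U Y -> vfield U Z -> U x ->
  mderiv (fun y => g y (Y y) (Z y)) x v =
    g x (nabla x v Y) (Z x) + g x (Y x) (nabla x v Z).

(* nabla_X Y - nabla_Y X = [X, Y], as derivations. *)
Definition torsion_free (nabla : cov_deriv) : Prop :=
  forall (U : set M) X Y (f : M -> R) x, open U -> vfield U X -> vfield U Y ->
  msmooth U f -> U x ->
  mderiv f x (nabla x (X x) Y - nabla x (Y x) X) =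
    mderiv (fun y => mderiv f y (Y y)) x (X x)
    - mderiv (fun y => mderiv f y (X y)) x (Y x).

Record levi_civita (g : metric) (nabla : cov_deriv) : Prop := {
  lc_connection : connection nabla;
  lc_metric : metric_compatible g nabla;
  lc_torsion_free : torsion_free nabla
}.

Definition fr (e : M -> 'M[R]_7) (j : 'I_7) : M -> vec7 R :=
  fun y => col j (e y).

Definition smooth_frame (U : set M) (e : M -> 'M[R]_7) : Prop :=
  forall j, vfield U (fr e j).

Definition orthonormal_frame (g : metric) (U : set M) (e : M -> 'M[R]_7) : Prop :=
  smooth_frame U e /\
  forall x, U x -> forall i j, g x (fr e i x) (fr e j x) = (i == j)%:R.

(* The pullback of the connection form of nabla by the local frame e, with     *)
(* values in so(7) for a metric connection: nabla_v e_j = sum_i omega_ij e_i.  *)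
Definition conn_form (g : metric) (nabla : cov_deriv) (e : M -> 'M[R]_7)
    (x : M) (v : vec7 R) : 'M[R]_7 :=
  \matrix_(i, j) g x (nabla x v (fr e j)) (fr e i x).

(* The divergence sum_i (nabla_{e_i} S)(e_i) at x, in the orthonormal frame e. *)
Definition divergence (nabla : cov_deriv) (S : M -> 'M[R]_7) (e : M -> 'M[R]_7)
    (x : M) : vec7 R :=
  \sum_i (nabla x (fr e i x) (fun y => S y *m fr e i y)
          - S x *m nabla x (fr e i x) (fr e i)).

Definition div_free (g : metric) (nabla : cov_deriv) (S : M -> 'M[R]_7) : Prop :=
  forall (U : set M) e x, open U -> orthonormal_frame g U e -> U x ->
  divergence nabla S e x = 0.

End Calculus.

Section SpinGeometry.
Context (R : realType) (c : {linear vec7 R -> 'M[R]_8}) (M : manifold R).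
Context (g : metric M).

(* A spin structure, as a lift to Spin(7) of the transition functions between  *)
(* local sections of SO(M): the local section e_a of SO(M) lifts to a local    *)
(* section s_a of the Spin(7)-bundle, and s_b = s_a h_ab.                      *)
Record spin_structure := SpinStructure {
  spin_idx : Type;
  spin_dom : spin_idx -> set M;
  spin_frame : spin_idx -> M -> 'M[R]_7;
  spin_trans : spin_idx -> spin_idx -> M -> 'M[R]_8;
  spin_dom_open : forall a, open (spin_dom a);
  spin_dom_cover : forall x, exists a, spin_dom a x;
  spin_frame_orthonormal : forall a,
    orthonormal_frame g (spin_dom a) (spin_frame a);
  spin_frame_oriented : forall a x, spin_dom a x -> 0 < \det (spin_frame a x);
  spin_trans_smooth : forall a b,
    msmooth (spin_dom a `&` spin_dom b) (spin_trans a b);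
  spin_trans_lift : forall a b x, spin_dom a x -> spin_dom b x ->
    exists2 A, spin_covers c (spin_trans a b x) A &
      spin_frame b x = spin_frame a x *m A;
  spin_trans_cocycle : forall a b d x,
    spin_dom a x -> spin_dom b x -> spin_dom d x ->
    spin_trans a b x *m spin_trans b d x = spin_trans a d x
}.

Context (Q : spin_structure).

(* A section of S(M), by its components: phi = [s_a, phi_a] on spin_dom a. *)
Definition spinor_components := spin_idx Q -> M -> spinor R.

Record unit_spinor_field (phi : spinor_components) : Prop := {
  spinor_smooth : forall a, msmooth (spin_dom a) (phi a);
  spinor_glue : forall a b x, spin_dom a x -> spin_dom b x ->
    phi a x = spin_trans a b x *m phi b x;
  spinor_unit : forall a x, spin_dom a x -> dot (phi a x) (phi a x) = 1
}.

(* The component in s_a of the Clifford product of X and phi at x. *)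
Definition clifford_mul (phi : spinor_components) (a : spin_idx Q) (x : M)
    (X : vec7 R) : spinor R :=
  c (invmx (spin_frame a x) *m X) *m phi a x.

(* The component in s_a of nabla_v phi at x, for the connection on S(M)        *)
(* induced by nabla: v(phi_a) + 1/2 sum_(i<j) g(nabla_v e_i, e_j) e_i e_j phi_a*)
(* (the terms with i = j below vanish). Here 1/2 e_i e_j is the image under    *)
(* the differential of lambda^-1 of the rotation generator e_i |-> e_j.        *)
Definition spin_nabla (nabla : cov_deriv M) (phi : spinor_components)
    (a : spin_idx Q) (x : M) (v : vec7 R) : spinor R :=
  mderiv (phi a) x v +
  4^-1 *: \sum_i \sum_j
    g x (nabla x v (fr (spin_frame a) i)) (fr (spin_frame a) j x) *:
      (c (basis7 R i) *m c (basis7 R j) *m phi a x).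

Definition spinor_endo (nabla : cov_deriv M) (phi : spinor_components)
    (S : M -> 'M[R]_7) : Prop :=
  forall a x v, spin_dom a x ->
  spin_nabla nabla phi a x v = clifford_mul phi a x (S x *m v).

Context (phi0 : spinor R).

(* The G2-reduction P of SO(M): the frames covered by spin frames s_a(x) h in  *)
(* which phi has the component phi0, i.e. phi(x) = [s_a(x) h, phi0].           *)
Definition g2_frames (phi : spinor_components) (x : M) : set 'M[R]_7 :=
  [set E | exists a h A, [/\ spin_dom a x, spin_covers c h A,
     E = spin_frame a x *m A & phi a x = h *m phi0]].

Definition g2_section (phi : spinor_components) (U : set M)
    (e : M -> 'M[R]_7) : Prop :=
  smooth_frame U e /\ forall x, U x -> g2_frames phi x (e x).

(* nablaG is the connection given by the g2-component of the connection form   *)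
(* of nabla restricted to P.                                                   *)
Definition g2_connection (nabla : cov_deriv M) (phi : spinor_components)
    (nablaG : cov_deriv M) : Prop :=
  connection nablaG /\
  forall U e x v, open U -> g2_section phi U e -> U x ->
    exists2 B, g2_component c phi0 (conn_form g nabla e x v) B &
      forall j, nablaG x v (fr e j) = \sum_i B i j *: fr e i x.

End SpinGeometry.

Section Torsion.
Context (R : realType) (M : manifold R).

Definition tensor12 := M -> vec7 R -> vec7 R -> vec7 R.

Definition intrinsic_torsion (nabla nablaG : cov_deriv M) (xi : tensor12) : Prop :=
  forall (U : set M) Y x v, open U -> vfield U Y -> U x ->
  xi x v (Y x) = nablaG x v Y - nabla x v Y.

(* (nabla_v xi)_X Y at x, for vector fields X and Y. *)
Definition cov_tensor (nabla : cov_deriv M) (xi : tensor12) (x : M) (v : vec7 R)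
    (X Y : M -> vec7 R) : vec7 R :=
  nabla x v (fun y => xi y (X y) (Y y))
  - xi x (nabla x v X) (Y x) - xi x (X x) (nabla x v Y).

(* L = sum_i (nabla_{e_i} xi)_{e_i} vanishes, as a section of End(TM). *)
Definition harmonic_g2 (g : metric M) (nabla : cov_deriv M) (xi : tensor12) : Prop :=
  forall (U : set M) e Y x, open U -> orthonormal_frame g U e -> vfield U Y ->
  U x -> \sum_i cov_tensor nabla xi x (fr e i x) (fr e i) Y = 0.

End Torsion.

(* Main.v *)
Require Import Defs.
From mathcomp Require Import all_boot all_order all_algebra.
From mathcomp Require Import all_classical all_reals all_analysis.
From mathcomp Require Import ring lra.

(** Fix a unit spinor [a] of [R^8]. The trilinear form
    [T(X, Y, Z) = <X . Y . a, Z . a>] is the 3-form of the G2-structure of [a],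
    and its variation when [a] moves along [W . a] is again an alternating form,
    [Psi(X, Y, Z, W)]. Both are non-degenerate. The algebra of G2 enters only
    through two facts: the elements of [g2], acting as derivations, annihilate
    [T], and those of [m] are contractions [C_ij = T(e_i, e_j, V)] of [T] with a
    vector [V].

    On the manifold, a spin frame identifies every tangent space with [R^7] and
    [phi] with a function into the unit spinors, so [T] and [Psi] become
    tensors. As the Clifford product is parallel and [nabla_v phi = S v . phi],
    the derivative of [T] along [v] is [nabla_v T = Psi(_, _, _, S v)]
    ([mderiv_spinor_form]).

    In a local section of the G2-reduction the components of [T] are constant.
    Write the connection form there as [B + C] with [B] in [g2] and [C] in [m].
    The part [B] does not move [T], so the last formula determines the action
    of [C] on [T], and thereby [C] itself: the intrinsic torsion is
    [<xi_v w, z> = 2/3 T(z, w, S v)] ([torsion_spinor_endo]). Local sections of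
    the reduction exist ([local_g2_lift]) because products of four unit vectors
    move [phi0] to any spinor near a given one, where two of the vectors are
    constant and the others are, up to normalization, rational in the spinor.

    Differentiating this expression of [xi] once more gives
    [<(nabla_v xi)_X Y, Z> = 2/3 (T(Z, Y, (nabla_v S) X) + Psi(Z, Y, S X, S v))]
    ([cov_tensor_torsion]). For [v = X = e_i] the last term vanishes, since
    [Psi] is alternating, and the sum over [i] is
    [<L Y, Z> = 2/3 T(Z, Y, div S)]. Non-degeneracy of [T] then says that
    [L = 0] exactly when [div S = 0]. *)

Set Implicit Arguments.
Unset Strict Implicit.
Unset Printing Implicit Defensive.

Import Order.TTheory GRing.Theory Num.Theory.
Import numFieldNormedType.Exports.

Local Open Scope classical_set_scope.
Local Open Scope ring_scope.

(** * The inner product of column vectors *)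

Section Dot.
Context (R : realType).

Lemma dotE n (u v : 'cV[R]_n) : dot u v = (u^T *m v) 0 0.
Proof. by rewrite mxE; apply: eq_bigr => i _; rewrite mxE. Qed.

Lemma dotC n (u v : 'cV[R]_n) : dot u v = dot v u.
Proof. by apply: eq_bigr => i _; rewrite mulrC. Qed.

Lemma dotDl n (u v w : 'cV[R]_n) : dot (u + v) w = dot u w + dot v w.
Proof. by rewrite !dotE linearD mulmxDl mxE. Qed.

Lemma dotZl n a (u w : 'cV[R]_n) : dot (a *: u) w = a * dot u w.
Proof. by rewrite !dotE linearZ -scalemxAl mxE. Qed.

Lemma dotNl n (u w : 'cV[R]_n) : dot (- u) w = - dot u w.
Proof. by rewrite -scaleN1r dotZl mulN1r. Qed.

Lemma dotDr n (u v w : 'cV[R]_n) : dot w (u + v) = dot w u + dot w v.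
Proof. by rewrite !(dotC w) dotDl. Qed.

Lemma dotZr n a (u w : 'cV[R]_n) : dot w (a *: u) = a * dot w u.
Proof. by rewrite !(dotC w) dotZl. Qed.

Lemma dotNr n (u w : 'cV[R]_n) : dot w (- u) = - dot w u.
Proof. by rewrite !(dotC w) dotNl. Qed.

Lemma dot0l n (w : 'cV[R]_n) : dot 0 w = 0.
Proof. by rewrite -(scale0r 0) dotZl mul0r. Qed.

Lemma dot0r n (w : 'cV[R]_n) : dot w 0 = 0.
Proof. by rewrite dotC dot0l. Qed.

Lemma dot_suml n I (r : seq I) (P : pred I) (F : I -> 'cV[R]_n) w :
  dot (\sum_(i <- r | P i) F i) w = \sum_(i <- r | P i) dot (F i) w.
Proof.
elim/big_rec2: _ => [|i x y _ <-]; first exact: dot0l.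
by rewrite dotDl.
Qed.

Lemma dot_sumr n I (r : seq I) (P : pred I) (F : I -> 'cV[R]_n) w :
  dot w (\sum_(i <- r | P i) F i) = \sum_(i <- r | P i) dot w (F i).
Proof. by rewrite dotC dot_suml; apply: eq_bigr => i _; rewrite dotC. Qed.

Definition dot_linear := (dotDl, dotDr, dotZl, dotZr, dotNl, dotNr, dot0l, dot0r).

Lemma dot_mulmx m n (A : 'M[R]_(m, n)) u v : dot (A *m u) v = dot u (A^T *m v).
Proof. by rewrite !dotE trmx_mul mulmxA. Qed.

Lemma dot_ge0 n (u : 'cV[R]_n) : 0 <= dot u u.
Proof. by apply: sumr_ge0 => i _; rewrite -expr2 sqr_ge0. Qed.

Lemma dot_eq0 n (u : 'cV[R]_n) : (dot u u == 0) = (u == 0).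
Proof.
apply/eqP/eqP => [h|->]; last exact: dot0l.
apply/colP => i; rewrite mxE; apply/eqP; rewrite -sqrf_eq0 expr2; apply/eqP.
apply: (@psumr_eq0P _ _ xpredT (fun j => u j 0 * u j 0)) => // j _.
by rewrite -expr2 sqr_ge0.
Qed.

Lemma dot_basisl (i : 'I_7) (u : 'cV[R]_7) : dot (basis7 R i) u = u i 0.
Proof.
rewrite /dot (bigD1 i) //= big1 => [|j /negPf ji]; rewrite mxE ?eqxx ?ji ?mul0r //.
by rewrite mul1r addr0.
Qed.

Lemma dot_basisr (i : 'I_7) (u : 'cV[R]_7) : dot u (basis7 R i) = u i 0.
Proof. by rewrite dotC dot_basisl. Qed.

Lemma basis7_dec (u : 'cV[R]_7) : u = \sum_i u i 0 *: basis7 R i.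
Proof.
apply/colP => i; rewrite summxE (bigD1 i) //= big1 => [|j /negPf ji].
  by rewrite !mxE eqxx mulr1 addr0.
by rewrite !mxE eq_sym ji mulr0.
Qed.

Lemma unit_normalize n (u : 'cV[R]_n) : u != 0 ->
  dot ((Num.sqrt (dot u u))^-1 *: u) ((Num.sqrt (dot u u))^-1 *: u) = 1.
Proof.
move=> u0; have d0 : dot u u != 0 by rewrite dot_eq0.
by rewrite !dot_linear mulrA -invfM -expr2 sqr_sqrtr ?dot_ge0// mulVf.
Qed.

(** The orthogonality conditions form a homogeneous linear system with fewer
    equations than unknowns. *)
Lemma exists_orthogonal (m n : nat) (F : 'I_m -> 'cV[R]_n) : (m < n)%N ->
  exists2 u : 'cV[R]_n, u != 0 & forall i, dot (F i) u = 0.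
Proof.
move=> mn; pose A : 'M[R]_(n, m) := \matrix_(i, j) F j i 0.
have : (kermx A != 0).
  by rewrite -mxrank_eq0 mxrank_ker subn_eq0 -ltnNge (leq_ltn_trans (rank_leq_col A)).
case/rowV0Pn => v /sub_kermxP vA v0.
exists v^T; first by apply: contra_neq v0 => /(congr1 trmx); rewrite trmxK trmx0.
move=> i; have := congr1 (fun x : 'rV_m => x 0 i) vA; rewrite [RHS]mxE mxE => <-.
by apply: eq_bigr => j _; rewrite !mxE mulrC.
Qed.

End Dot.

(** * The real Clifford module of R^7 and its spinors *)

Section Clifford.
Context (R : realType) (c : {linear 'cV[R]_7 -> 'M[R]_8}) (hc : clifford_module c).
Local Notation "X *c a" := (c X *m a) (at level 35, right associativity).
Local Notation e := (basis7 R).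
Implicit Types (a b : 'cV[R]_8) (X Y Z W : 'cV[R]_7) (A : 'M[R]_7).

Lemma clDr X a b : X *c (a + b) = X *c a + X *c b.
Proof. exact: mulmxDr. Qed.
Lemma clNr X a : X *c (- a) = - (X *c a).
Proof. exact: mulmxN. Qed.
Lemma clZr X k a : X *c (k *: a) = k *: (X *c a).
Proof. by rewrite scalemxAr. Qed.
Lemma clDl X Y a : (X + Y) *c a = X *c a + Y *c a.
Proof. by rewrite linearD mulmxDl. Qed.
Lemma clNl X a : (- X) *c a = - (X *c a).
Proof. by rewrite linearN mulNmx. Qed.
Lemma clZl X k a : (k *: X) *c a = k *: (X *c a).
Proof. by rewrite linearZ scalemxAl. Qed.
Lemma cl0l a : 0 *c a = 0.
Proof. by rewrite linear0 mul0mx. Qed.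
Definition cl_linear := (clDl, clNl, clZl, clDr, clNr, clZr, cl0l).

Lemma cl_sqr X a : X *c X *c a = - dot X X *: a.
Proof. by rewrite mulmxA (clifford_sqr hc) mul_scalar_mx. Qed.

Lemma cl_swap X Y a : X *c Y *c a = - (Y *c X *c a) - (2 * dot X Y) *: a.
Proof.
have := cl_sqr (X + Y) a; rewrite !cl_linear !cl_sqr !dot_linear (dotC Y X).
set p := X *c _; set q := Y *c _ => h.
have -> : p = (- dot X X *: a + p + (q + - dot Y Y *: a)) - q
    + dot X X *: a + dot Y Y *: a.
  by apply/colP => i; rewrite !mxE; ring.
by rewrite h; apply/colP => i; rewrite !mxE; ring.
Qed.

(** A unit vector [X] acts as an isometry with square [-1], hence as a skew
    endomorphism; the general case follows by scaling. *)
Lemma cl_skew X a b : dot (X *c a) b = - dot a (X *c b).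
Proof.
have [->|X0] := eqVneq X 0; first by rewrite !cl0l !dot_linear oppr0.
set r := Num.sqrt (dot X X).
have r0 : r != 0 by rewrite sqrtr_eq0 -ltNge lt_neqAle dot_ge0 eq_sym dot_eq0 X0.
have [Y Y1 ->] : exists2 Y, dot Y Y = 1 & X = r *: Y.
  by exists (r^-1 *: X); [exact: unit_normalize | rewrite scalerA divff ?scale1r].
rewrite !cl_linear !dot_linear -mulrN; congr (_ * _).
rewrite -(clifford_orth hc a (Y *c b) Y1) cl_sqr Y1 !dot_linear; ring.
Qed.

Lemma cl_dot X a b : dot (X *c a) (X *c b) = dot X X * dot a b.
Proof. by rewrite cl_skew cl_sqr !dot_linear; ring. Qed.

Lemma cl_dot_vec X Y a : dot (X *c a) (Y *c a) = dot X Y * dot a a.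
Proof.
have := cl_dot (X + Y) a a; rewrite !cl_linear !dot_linear !cl_dot.
rewrite (dotC (Y *c _)) (dotC Y X); lra.
Qed.

Lemma cl_dot_self X a : dot (X *c a) a = 0.
Proof. by have := cl_skew X a a; rewrite (dotC a); lra. Qed.

Lemma cl_dot_selfr X a : dot a (X *c a) = 0.
Proof. by rewrite dotC cl_dot_self. Qed.

(** The vector part of [b] in the decomposition of the spinors into the line
    of [a] and the space of all [X . a]. *)
Definition spinor_vec (a b : 'cV[R]_8) : 'cV[R]_7 := \col_i dot b (e i *c a).

Lemma spinor_vecP a b X : dot (spinor_vec a b) X = dot b (X *c a).
Proof.
rewrite {2}(basis7_dec X) linear_sum mulmx_suml dot_sumr; apply: eq_bigr => i _.
by rewrite mxE clZl dot_linear mulrC.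
Qed.

(** The eight spinors [a], [e_i . a] are orthonormal, hence a basis of
    [R^8]: the square matrix [M] with these columns satisfies [M^T M = 1], and
    so [M M^T = 1]. *)
Lemma spinor_decomp a b : dot a a = 1 ->
  b = dot b a *: a + spinor_vec a b *c a.
Proof.
move=> a1.
pose F (i : 'I_8) : 'cV[R]_8 :=
  if fintype.split (i : 'I_(1 + 7)) is inr j then e j *c a else a.
have Forth i j : dot (F i) (F j) = (i == j)%:R.
  rewrite /F -(inj_eq (can_inj (@splitK 1 7))).
  case: (fintype.split _) => i'; case: (fintype.split _) => j' /=.
  - by rewrite !ord1 a1 eqxx.
  - by rewrite cl_dot_selfr.
  - by rewrite cl_dot_self.
  - by rewrite cl_dot_vec a1 mulr1 dot_basisl mxE eqxx andbT.
pose M : 'M[R]_8 := \matrix_(i, j) F j i 0.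
have MM : M^T *m M = 1%:M.
  apply/matrixP => i j; rewrite !mxE -Forth.
  by apply: eq_bigr => k _; rewrite !mxE.
have MM' : M *m M^T = 1%:M by exact: mulmx1C.
have -> : spinor_vec a b *c a = \sum_j dot b (e j *c a) *: (e j *c a).
  rewrite {1}(basis7_dec (spinor_vec a b)) linear_sum mulmx_suml.
  by apply: eq_bigr => j _; rewrite clZl mxE.
rewrite -[LHS]mul1mx -MM' -mulmxA.
transitivity (\sum_(i < 8) dot b (F i) *: F i).
  apply/colP => k; rewrite mxE summxE; apply: eq_bigr => i _.
  rewrite !mxE mulrC; congr (_ * _); apply: eq_bigr => l _; by rewrite !mxE mulrC.
rewrite (@big_split_ord _ _ _ 1 7) big_ord1.
congr (_ + _).
  by rewrite /F; case: splitP => // j /= hj; have := ltn_ord j; rewrite -hj.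
apply: eq_bigr => j _; rewrite /F.
case: splitP => /= k; last by move=> /addnI/val_inj ->.
by move=> hk; have := ltn_ord k; rewrite -hk.
Qed.

Lemma spinor_vec_cl a b : dot a a = 1 -> dot b a = 0 -> spinor_vec a b *c a = b.
Proof. by move=> a1 ba; rewrite [RHS](spinor_decomp _ a1) ba scale0r add0r. Qed.

(** The differential at the identity of the spin representation: an element of
    so(7) acts by the bivector that lifts it. *)
Definition spin_rep (A : 'M[R]_7) : 'M[R]_8 :=
  4^-1 *: \sum_i \sum_j A j i *: (c (e i) *m c (e j)).

Lemma spin_repE A a :
  spin_rep A *m a = 4^-1 *: \sum_i \sum_j A j i *: (e i *c e j *c a).
Proof.
rewrite /spin_rep -scalemxAl mulmx_suml; congr (_ *: _); apply: eq_bigr => i _.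
rewrite mulmx_suml; apply: eq_bigr => j _.
by rewrite -scalemxAl mulmxA.
Qed.

Lemma so7P A i j : so7 A -> A i j = - A j i :> R.
Proof. by move=> /(congr1 (fun M : 'M[R]_7 => M j i)); rewrite !mxE. Qed.

Lemma mulmx_basis (A : 'M[R]_7) X : A *m X = \sum_i \sum_j (A i j * X j 0) *: e i.
Proof.
rewrite {1}(basis7_dec (A *m X)); apply: eq_bigr => i _.
by rewrite mxE scaler_suml.
Qed.

Lemma spin_rep_skew A a b : so7 A ->
  dot (spin_rep A *m a) b = - dot a (spin_rep A *m b).
Proof.
move=> hA; rewrite !spin_repE !dot_linear -mulrN; congr (_ * _).
rewrite dot_suml dot_sumr -sumrN.
under eq_bigr do rewrite dot_suml.
rewrite exchange_big; apply: eq_bigr => i _ /=.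
rewrite dot_sumr -sumrN; apply: eq_bigr => j _.
by rewrite !dot_linear !cl_skew opprK (so7P i j hA) mulNr.
Qed.

(** The bivector lifting [A] acts on vectors by commutators, and this action is
    that of [A] itself. This makes all the forms built from the Clifford
    product equivariant. *)
Lemma spin_rep_comm A X a : so7 A ->
  spin_rep A *m (X *c a) = (A *m X) *c a + X *c (spin_rep A *m a).
Proof.
move=> hA.
have key i j : e i *c e j *c X *c a =
   X *c e i *c e j *c a + ((2 * X i 0) *: (e j *c a) - (2 * X j 0) *: (e i *c a)).
  rewrite (cl_swap (e j) X) !cl_linear (cl_swap (e i) X) !dot_basisl.
  by apply/colP => k; rewrite !mxE; ring.
have lhs : X *c (spin_rep A *m a) =
    4^-1 *: \sum_i \sum_j A j i *: (X *c e i *c e j *c a).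
  rewrite spin_repE clZr; congr (_ *: _); rewrite mulmx_sumr; apply: eq_bigr => i _.
  by rewrite mulmx_sumr; apply: eq_bigr => j _; rewrite clZr.
rewrite lhs spin_repE.
rewrite (eq_bigr (fun i => (\sum_j A j i *: (X *c e i *c e j *c a)) +
   \sum_j A j i *: ((2 * X i 0) *: (e j *c a) - (2 * X j 0) *: (e i *c a)))); last first.
  by move=> i _; rewrite -big_split; apply: eq_bigr => j _; rewrite key scalerDr.
rewrite big_split /= scalerDr addrC; congr (_ + _).
rewrite (eq_bigr (fun i => (\sum_j (2 * (A j i * X i 0)) *: (e j *c a)) +
   \sum_j (2 * (A i j * X j 0)) *: (e i *c a))); last first.
  move=> i _; rewrite -big_split; apply: eq_bigr => j _.
  by rewrite (so7P i j hA) /=; apply/colP => k; rewrite !mxE; ring.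
rewrite big_split /= exchange_big /= -big_split /=.
rewrite [in RHS]mulmx_basis [in RHS]linear_sum mulmx_suml scaler_sumr.
apply: eq_bigr => i _; rewrite -big_split scaler_sumr [in RHS]linear_sum mulmx_suml.
apply: eq_bigr => j _ /=.
rewrite !cl_linear -scalerDl scalerA; congr (_ *: _); by field.
Qed.

(** For a unit spinor [a], this is the 3-form of the G2-structure that it defines. *)
Definition three_form a X Y Z := dot (X *c Y *c a) (Z *c a).

(** The derivative of [three_form a X Y Z] when the spinor [a] moves with
    velocity [W . a]. For a unit spinor it is alternating: up to sign, twice the
    4-form dual to the 3-form of [a]. *)
Definition four_form a X Y Z W :=
  dot (X *c Y *c W *c a) (Z *c a) + dot (X *c Y *c a) (Z *c W *c a).

Definition contract_three_form a (A : 'M[R]_7) : 'cV[R]_7 :=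
  \col_k \sum_i \sum_j A i j * three_form a (e i) (e j) (e k).

(** The spinor [spin_rep A a] is orthogonal to [a], as [spin_rep A] is skew,
    so it is the product of a vector with [a], whose coordinates are read off
    from the 3-form. *)
Lemma spin_rep_vec a A : dot a a = 1 -> so7 A ->
  spin_rep A *m a = (- 4^-1 *: contract_three_form a A) *c a.
Proof.
move=> a1 hA; rewrite -[LHS](spinor_vec_cl a1); last first.
  by have := spin_rep_skew a a hA; rewrite (dotC a); lra.
congr (_ *c _); apply/colP => k; rewrite !mxE spin_repE !dot_linear mulNr -mulrN.
congr (_ * _); rewrite -sumrN dot_suml; apply: eq_bigr => i _.
rewrite dot_suml -sumrN; apply: eq_bigr => j _.
by rewrite dot_linear (so7P j i hA) mulNr.
Qed.

(** Rotating the three vectors infinitesimally by [A] has the same effect as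
    rotating the spinor by [- A], because rotating all four leaves the form
    invariant. *)
Lemma three_form_so7 a A X Y Z : so7 A ->
  three_form a (A *m X) Y Z + three_form a X (A *m Y) Z + three_form a X Y (A *m Z)
  = - (dot (X *c Y *c (spin_rep A *m a)) (Z *c a)
       + dot (X *c Y *c a) (Z *c (spin_rep A *m a))).
Proof.
move=> hA; rewrite /three_form.
have E1 := spin_rep_comm X (Y *c a) hA.
have E2 := spin_rep_comm Y a hA.
have E3 := spin_rep_comm Z a hA.
have := spin_rep_skew (X *c Y *c a) (Z *c a) hA.
rewrite E1 E2 E3 clDr !dot_linear; lra.
Qed.

Lemma three_form_lin1 a k X X' Y Z : three_form a (k *: X + X') Y Z =
  k * three_form a X Y Z + three_form a X' Y Z.
Proof. by rewrite /three_form !cl_linear !dot_linear. Qed.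
Lemma three_form_lin2 a k X X' Y Z : three_form a Y (k *: X + X') Z =
  k * three_form a Y X Z + three_form a Y X' Z.
Proof. by rewrite /three_form !cl_linear !dot_linear. Qed.
Lemma three_form_lin3 a k X X' Y Z : three_form a Y Z (k *: X + X') =
  k * three_form a Y Z X + three_form a Y Z X'.
Proof. by rewrite /three_form !cl_linear !dot_linear. Qed.

Lemma three_formB1 a X X' Y Z :
  three_form a (X - X') Y Z = three_form a X Y Z - three_form a X' Y Z.
Proof. by rewrite /three_form !cl_linear !dot_linear. Qed.
Lemma three_formB2 a X X' Y Z :
  three_form a Y (X - X') Z = three_form a Y X Z - three_form a Y X' Z.
Proof. by rewrite /three_form !cl_linear !dot_linear. Qed.
Lemma three_formB3 a X X' Y Z :
  three_form a Y Z (X - X') = three_form a Y Z X - three_form a Y Z X'.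
Proof. by rewrite /three_form !cl_linear !dot_linear. Qed.

(** Commuting [W] to the front of [X . Y . W . a] turns the first summand of the
    form into [|W|^2 <X . Y . a, a>], which the second one cancels. *)
Lemma four_form_alt a X Y W : four_form a X Y W W = 0.
Proof.
rewrite /four_form cl_sqr (cl_swap Y W) !cl_linear (cl_swap X W) !dot_linear.
rewrite cl_dot !cl_dot_vec.
by rewrite (dotC Y W); ring.
Qed.

Lemma four_formB a X Y Z W W' :
  four_form a X Y Z (W - W') = four_form a X Y Z W - four_form a X Y Z W'.
Proof. by rewrite /four_form !cl_linear !dot_linear; ring. Qed.

Lemma exists_orthogonal3 (u v w : 'cV[R]_7) :
  exists2 x, x != 0 & [/\ dot u x = 0, dot v x = 0 & dot w x = 0].
Proof.
have [x x0 h] := exists_orthogonal (tnth [tuple u; v; w]) (isT : 3 < 7)%N.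
by exists x => //; split; [apply: (h 0) | apply: (h 1) | apply: (h 2)].
Qed.

(** If [X], [Y], [W] are pairwise orthogonal and [W] is orthogonal to the cross
    product of [X] and [Y], then [X . Y . W . a = Z . a] for a vector [Z], and
    for this [Z] the form takes the value [2 |X|^2 |Y|^2 |W|^2]. Such non-zero
    [X] and [Y] exist for dimension reasons. *)
Lemma four_form_nondeg a W : dot a a = 1 ->
  (forall X Y Z, four_form a X Y Z W = 0) -> W = 0.
Proof.
move=> a1 h.
have [X X0 [WX _ _]] := exists_orthogonal3 W W W.
have [Y Y0 [WY XY UY]] := exists_orthogonal3 W X (spinor_vec a (X *c W *c a)).
move: UY; rewrite spinor_vecP => UY.
have XYWa : dot (X *c Y *c W *c a) a = 0.
  by rewrite (cl_swap X Y) XY mulr0 scale0r subr0 dotNl cl_skew UY opprK.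
have := h X Y (spinor_vec a (X *c Y *c W *c a)).
set Z := spinor_vec _ _; have Za : Z *c a = X *c Y *c W *c a by exact: spinor_vec_cl.
rewrite /four_form (cl_swap Z W) Za !dot_linear.
have -> : dot (X *c Y *c a) a = 0.
  by rewrite cl_skew cl_dot_vec (dotC Y) XY mul0r oppr0.
rewrite -cl_skew.
have -> : W *c X *c Y *c a = X *c Y *c W *c a.
  by rewrite (cl_swap W X) (cl_swap W Y) !cl_linear WX WY !mulr0 !scale0r !subr0 opprK.
rewrite !cl_dot a1 => hh.
have : dot X X * (dot Y Y * dot W W) = 0 by lra.
move/eqP; rewrite !mulf_eq0 !dot_eq0 (negPf X0) (negPf Y0) => /eqP//.
Qed.

(** For [X] orthogonal to [W] the spinor [X . W . a] is [Y . a] for a vector [Y],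
    and for this [Y] the form takes the value [- |X|^2 |W|^2]. *)
Lemma three_form_nondeg a W : dot a a = 1 ->
  (forall X Y, three_form a X Y W = 0) -> W = 0.
Proof.
move=> a1 h.
have [X X0 [WX _ _]] := exists_orthogonal3 W W W.
have XWa : dot (X *c W *c a) a = 0 by rewrite cl_skew cl_dot_vec WX mul0r oppr0.
have := h X (spinor_vec a (X *c W *c a)).
rewrite /three_form spinor_vec_cl// cl_skew !cl_dot a1 => /eqP.
by rewrite oppr_eq0 mulr1 mulf_eq0 !dot_eq0 (negPf X0) => /eqP.
Qed.

End Clifford.

(** * Derivatives of matrix-valued functions *)

Section MatrixDerivatives.
Context (R : realType) (V : normedModType R).
Implicit Types x v : V.

Lemma is_derive_mxP m n (F : V -> 'M[R]_(m, n)) x v dF :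
  is_derive x v F dF <->
  forall i j, is_derive x v (fun y => F y i j) (dF i j).
Proof.
split=> [[Fx <-] i j|h].
  by rewrite derive_mx// mxE; exact/derivableP/(derivable_mxP _ _ _).1.
have Fx : derivable F x v by apply/derivable_mxP => i j; case: (h i j).
apply: DeriveDef => //; apply/matrixP => i j; rewrite derive_mx// mxE.
by case: (h i j).
Qed.

Lemma is_derive_bigsum n (F : 'I_n -> V -> R) x v (dF : 'I_n -> R) :
  (forall i, is_derive x v (F i) (dF i)) ->
  is_derive x v (fun y => \sum_i F i y) (\sum_i dF i).
Proof.
move=> h; have -> : (fun y => \sum_i F i y) = \sum_i F i.
  by apply/funext => y; rewrite fct_sumE.
exact: is_derive_sum.
Qed.

Lemma is_derive_sub (W : normedModType R) (f g : V -> W) x v df dg :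
  is_derive x v f df -> is_derive x v g dg ->
  is_derive x v (fun y => f y - g y) (df - dg).
Proof. exact: is_deriveB. Qed.

Lemma is_derive_mul (f g : V -> R) x v df dg :
  is_derive x v f df -> is_derive x v g dg ->
  is_derive x v (fun y => f y * g y) (df * g x + f x * dg).
Proof.
move=> hf hg; apply: is_derive_eq (is_deriveM hf hg) _.
by rewrite addrC; congr (_ + _); rewrite [_ *: _]mulrC.
Qed.

Lemma is_derive_mulmx m n p (F : V -> 'M[R]_(m, n)) (G : V -> 'M[R]_(n, p))
    x v dF dG :
  is_derive x v F dF -> is_derive x v G dG ->
  is_derive x v (fun y => F y *m G y) (dF *m G x + F x *m dG).
Proof.
move=> /is_derive_mxP hF /is_derive_mxP hG; apply/is_derive_mxP => i j.
rewrite (_ : (fun y => _) = fun y => \sum_k F y i k * G y k j); last first.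
  by apply/funext => y; rewrite mxE.
rewrite !mxE -big_split; apply: is_derive_bigsum => k; exact: is_derive_mul.
Qed.

Lemma is_derive_tr m n (F : V -> 'M[R]_(m, n)) x v dF :
  is_derive x v F dF -> is_derive x v (fun y => (F y)^T) dF^T.
Proof.
move=> /is_derive_mxP h; apply/is_derive_mxP => i j; rewrite mxE.
by rewrite (_ : (fun y => _) = fun y => F y j i)//; apply/funext => y; rewrite mxE.
Qed.

Lemma is_derive_const (W : normedModType R) (w : W) x v :
  is_derive x v (fun=> w) 0.
Proof. exact: is_derive_cst. Qed.

Lemma is_derive_linear m n p (L : {linear 'cV[R]_p -> 'M[R]_(m, n)}) F x v dF :
  is_derive x v F dF -> is_derive x v (fun y => L (F y)) (L dF).
Proof.
move=> /is_derive_mxP h; apply/is_derive_mxP => i j.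
have LE (u : 'cV[R]_p) : L u i j = \sum_k u k 0 * L (delta_mx k 0) i j.
  rewrite {1}(_ : u = \sum_k u k 0 *: delta_mx k 0); last first.
    rewrite [LHS]matrix_sum_delta; apply: eq_bigr => k _.
    by rewrite big_ord1.
  rewrite linear_sum summxE; apply: eq_bigr => k _.
  by rewrite linearZ mxE.
rewrite (_ : (fun y => _) = fun y => \sum_k F y k 0 * L (delta_mx k 0) i j); last first.
  by apply/funext => y; rewrite LE.
rewrite LE; apply: is_derive_bigsum => k.
apply: is_derive_eq (is_derive_mul (h _ _) (is_derive_const _ _ _)) _.
by rewrite mulr0 addr0.
Qed.

Lemma is_derive_dot n (F G : V -> 'cV[R]_n) x v dF dG :
  is_derive x v F dF -> is_derive x v G dG ->
  is_derive x v (fun y => dot (F y) (G y)) (dot dF (G x) + dot (F x) dG).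
Proof.
move=> hF hG; have := is_derive_mulmx (is_derive_tr hF) hG.
move=> /is_derive_mxP/(_ 0 0); rewrite mxE -!dotE.
by under eq_fun do rewrite -dotE.
Qed.

Lemma is_derive_three_form (c : {linear 'cV[R]_7 -> 'M[R]_8})
    (F : V -> 'cV[R]_8) (X Y Z : V -> 'cV[R]_7) x v dF dX dY dZ :
  is_derive x v F dF -> is_derive x v X dX -> is_derive x v Y dY ->
  is_derive x v Z dZ ->
  is_derive x v (fun y => three_form c (F y) (X y) (Y y) (Z y))
    (three_form c (F x) dX (Y x) (Z x) + three_form c (F x) (X x) dY (Z x)
     + three_form c (F x) (X x) (Y x) dZ
     + (dot (c (X x) *m (c (Y x) *m dF)) (c (Z x) *m F x)
        + dot (c (X x) *m (c (Y x) *m F x)) (c (Z x) *m dF))).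
Proof.
move=> hF hX hY hZ; rewrite /three_form.
apply: is_derive_eq.
  apply: is_derive_dot.
    apply: is_derive_mulmx (is_derive_linear _ hX) _.
    exact: is_derive_mulmx (is_derive_linear _ hY) hF.
  exact: is_derive_mulmx (is_derive_linear _ hZ) hF.
by rewrite !(mulmxDr, dot_linear); ring.
Qed.

End MatrixDerivatives.

(** * Spin(7) and its covering of SO(7) *)

Section Spin7.
Context (R : realType) (c : {linear 'cV[R]_7 -> 'M[R]_8}) (hc : clifford_module c).
Local Notation "X *c a" := (c X *m a) (at level 35, right associativity).
Local Notation e := (basis7 R).
Implicit Types (a b : 'cV[R]_8) (X Y Z U W : 'cV[R]_7) (A B C : 'M[R]_7).
Implicit Types (h : 'M[R]_8).

Lemma eq_mx8 h h' : (forall a, h *m a = h' *m a) -> h = h'.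
Proof.
move=> E; apply/matrixP => i j.
have /(congr1 (fun M : 'cV[R]_8 => M i 0)) := E (delta_mx j 0).
by rewrite -!colE !mxE.
Qed.

Lemma spin7_dot h a b : Spin7 c h -> dot (h *m a) (h *m b) = dot a b.
Proof.
move=> [s [hs _] ->]; elim: s hs => [|X s IH] hs; first by rewrite big_nil !mul1mx.
rewrite big_cons -mulmxE -!mulmxA cl_dot// hs ?mem_head// mul1r IH// => Y Ys.
by apply: hs; rewrite inE Ys orbT.
Qed.

Lemma spin_covers_mul h h' A B : spin_covers c h A -> spin_covers c h' B ->
  spin_covers c (h *m h') (A *m B).
Proof.
move=> [[s [hs os] ->] hA] [[s' [hs' os'] ->] hB]; split.
  exists (s ++ s'); last by rewrite big_cat.
  split; last by rewrite size_cat oddD (negPf os) (negPf os').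
  by move=> X; rewrite mem_cat => /orP[/hs|/hs'].
by move=> X; rewrite -mulmxA hB mulmxA hA -!mulmxA.
Qed.

Lemma covers_three_form h A a X Y Z : spin_covers c h A ->
  three_form c (h *m a) (A *m X) (A *m Y) (A *m Z) = three_form c a X Y Z.
Proof.
move=> [hh hA]; rewrite /three_form.
have E W b : (A *m W) *c (h *m b) = h *m (W *c b) by rewrite mulmxA -hA mulmxA.
by rewrite !E spin7_dot.
Qed.

Lemma covers_four_form h A a X Y Z W : spin_covers c h A ->
  four_form c (h *m a) (A *m X) (A *m Y) (A *m Z) (A *m W) = four_form c a X Y Z W.
Proof.
move=> [hh hA]; rewrite /four_form.
have E U b : (A *m U) *c (h *m b) = h *m (U *c b) by rewrite mulmxA -hA mulmxA.
by rewrite !E !spin7_dot.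
Qed.

(** The reflection in the hyperplane orthogonal to [U], in a form that is
    rational in [U], so that no normalization is involved when [U] varies. *)
Definition reflection (U : 'cV[R]_7) : 'M[R]_7 := 1%:M - (2 / dot U U) *: (U *m U^T).

Lemma reflectionE U X : reflection U *m X = X - (2 / dot U U * dot U X) *: U.
Proof.
rewrite mulmxBl mul1mx -scalemxAl -mulmxA -scalerA; congr (_ - _ *: _).
apply/colP => i; rewrite mxE big_ord1 !mxE mulrC dotE; congr (_ * _).
by rewrite mxE.
Qed.

(** The adjoint action of a vector on vectors is minus the reflection in it. *)
Lemma cl_reflection U X a : U != 0 ->
  U *c X *c a = - ((reflection U *m X) *c U *c a).
Proof.
rewrite -dot_eq0 => U0; rewrite reflectionE (cl_swap hc U X) !cl_linear cl_sqr//.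
by apply/colP => i; rewrite !mxE; field.
Qed.

Lemma reflectionZ k U : k != 0 -> reflection (k *: U) = reflection U.
Proof.
move=> k0; have [->|] := eqVneq U 0; first by rewrite scaler0.
rewrite -dot_eq0 => U0; apply/matrixP => i j.
rewrite /reflection !mxE !big_ord1 !mxE !dot_linear; congr (_ - _); field.
by rewrite U0 k0.
Qed.

Lemma covers_reflections U W : dot U U = 1 -> dot W W = 1 ->
  spin_covers c (c W *m c U) (reflection W *m reflection U).
Proof.
have n0 X : dot X X = 1 -> X != 0 by rewrite -dot_eq0 => ->; exact: oner_neq0.
move=> U1 W1; split.
  exists [:: W; U]; last by rewrite !big_cons big_nil mulr1.
  by split => // X; rewrite !inE => /orP[] /eqP->.
move=> X; apply: eq_mx8 => a; rewrite -!mulmxA.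
by rewrite (cl_reflection _ _ (n0 _ U1)) clNr (cl_reflection _ _ (n0 _ W1)) opprK.
Qed.

End Spin7.

(** * The Lie algebra of the stabilizer of a spinor *)

Section G2.
Context (R : realType) (c : {linear 'cV[R]_7 -> 'M[R]_8}) (hc : clifford_module c).
Context (a : 'cV[R]_8).
Local Notation "X *c a" := (c X *m a) (at level 35, right associativity).
Local Notation e := (basis7 R).
Implicit Types (X Y Z U W : 'cV[R]_7) (A B C : 'M[R]_7).
Local Notation T := (three_form c a).

(** The 3-form of [a] is constant along every curve in the stabilizer of [a]. *)
Lemma lie_g2_three_form B X Y Z : lie_g2 c a B ->
  T (B *m X) Y Z + T X (B *m Y) Z + T X Y (B *m Z) = 0.
Proof.
move=> [gam [hG g0] hB].
have hmul W : is_derive (0 : R) (1 : R) (fun t => gam t *m W) (B *m W).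
  apply: is_derive_eq (is_derive_mulmx hB (is_derive_const _ _ _)) _.
  by rewrite mulmx0 addr0.
have := is_derive_three_form c (is_derive_const a _ _) (hmul X) (hmul Y) (hmul Z).
rewrite g0 !mul1mx !mulmx0 !dot_linear !addr0.
rewrite (_ : (fun y => _) = fun=> T X Y Z); last first.
  by apply/funext => t; have [h hA {1}<-] := hG t; rewrite covers_three_form.
move=> [_ <-]; exact: derive_cst.
Qed.

Definition rotation_generator X Y : 'M[R]_7 := Y *m X^T - X *m Y^T.

Lemma is_derive_circle n (X Y : 'cV[R]_n) :
  is_derive (0 : R) (1 : R) (fun t => cos t *: X + sin t *: Y) Y.
Proof.
apply/is_derive_mxP => i j.
rewrite (_ : (fun y => _) = fun t => cos t * X i j + sin t * Y i j); last first.
  by apply/funext => t; rewrite !mxE.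
apply: is_derive_eq.
  by rewrite cos0 sin0 oppr0 !scaler0 !add0r [_ *: _]mulr1.
Qed.

Lemma circle_unit n (X Y : 'cV[R]_n) t : dot X X = 1 -> dot Y Y = 1 -> dot X Y = 0 ->
  dot (cos t *: X + sin t *: Y) (cos t *: X + sin t *: Y) = 1.
Proof.
move=> X1 Y1 XY; rewrite !dot_linear X1 Y1 (dotC Y) XY -[RHS](cos2Dsin2 t); ring.
Qed.

(** The rotation by the angle [2 t] in the plane of [X] and [Y], covered by
    [cos t + sin t X . Y = X . (- cos t X + sin t Y)]. *)
Definition plane_rotation X Y (t : R) : 'M[R]_7 :=
  reflection X *m reflection (cos t *: (- X) + sin t *: Y).

Lemma is_derive_plane_rotation X Y : dot X X = 1 -> dot Y Y = 1 -> dot X Y = 0 ->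
  is_derive (0 : R) (1 : R) (plane_rotation X Y) (2 *: rotation_generator X Y).
Proof.
move=> X1 Y1 XY.
have NX1 : dot (- X) (- X) = 1 by rewrite !dot_linear opprK.
have NXY : dot (- X) Y = 0 by rewrite dot_linear XY oppr0.
pose F t := cos t *: (- X) + sin t *: Y.
have hF : is_derive (0 : R) (1 : R) F Y by exact: is_derive_circle.
have F0 : F 0 = - X by rewrite /F cos0 sin0 scale1r scale0r addr0.
rewrite (_ : plane_rotation X Y =
  fun t => reflection X - (2 *: (reflection X *m F t)) *m (F t)^T); last first.
  apply/funext => t; rewrite /plane_rotation {2}/reflection circle_unit// divr1.
  by rewrite mulmxBr mulmx1 -scalemxAr -scalemxAl mulmxA.
have h2 : is_derive (0 : R) (1 : R) (fun t => 2 *: (reflection X *m F t))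
    (2 *: (reflection X *m Y)).
  rewrite (_ : (fun t => _) = fun t => (2 *: reflection X) *m F t); last first.
    by apply/funext => t; rewrite scalemxAl.
  apply: is_derive_eq (is_derive_mulmx (is_derive_const _ _ _) hF) _.
  by rewrite mul0mx add0r scalemxAl.
apply: is_derive_eq (is_derive_sub (is_derive_const _ _ _)
  (is_derive_mulmx h2 (is_derive_tr hF))) _.
rewrite F0 !reflectionE !dot_linear X1 XY divr1 !mulr0 ?scale0r.
rewrite subr0 /rotation_generator.
apply/matrixP => i j; rewrite !mxE !big_ord1 !mxE; ring.
Qed.

(** Both [X . Y] and [X' . Y'] send [a] to the same spinor, so the product of
    the inverse of [cos t + sin t X' . Y'] with [cos t + sin t X . Y] fixes [a].
    It covers a curve in G2 through the identity. *)
Lemma g2_rotations X Y X' Y' :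
  dot X X = 1 -> dot Y Y = 1 -> dot X Y = 0 ->
  dot X' X' = 1 -> dot Y' Y' = 1 -> dot X' Y' = 0 ->
  X *c Y *c a = X' *c Y' *c a ->
  lie_g2 c a (2 *: (rotation_generator X Y - rotation_generator X' Y')).
Proof.
move=> X1 Y1 XY X1' Y1' XY' E.
have mY' : dot (- Y') (- Y') = 1 by rewrite !dot_linear opprK.
have XmY' : dot X' (- Y') = 0 by rewrite dot_linear XY' oppr0.
have cov U W t : dot U U = 1 -> dot W W = 1 -> dot U W = 0 ->
    spin_covers c (c U *m c (cos t *: (- U) + sin t *: W)) (plane_rotation U W t).
  move=> U1 W1 UW; apply: covers_reflections => //; apply: circle_unit => //.
    by rewrite !dot_linear opprK.
  by rewrite dot_linear UW oppr0.
have rot0 U W : dot U U = 1 -> plane_rotation U W 0 = 1%:M.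
  move=> U1; rewrite /plane_rotation cos0 sin0 scale1r scale0r addr0.
  rewrite -scaleN1r reflectionZ ?oppr_eq0 ?oner_neq0//.
  rewrite {2}/reflection U1 divr1 mulmxBr mulmx1 -scalemxAr mulmxA reflectionE U1.
  rewrite divr1 mulr1 /reflection U1 divr1.
  apply/matrixP => i j; rewrite !mxE !big_ord1 !mxE; ring.
have act U W t : dot U U = 1 ->
    (c U *m c (cos t *: (- U) + sin t *: W)) *m a = cos t *: a + sin t *: (U *c W *c a).
  by move=> U1; rewrite -mulmxA !cl_linear cl_sqr// U1 scaleN1r !scalerN opprK.
exists (fun t => plane_rotation X' (- Y') t *m plane_rotation X Y t); first split.
- move=> t; eexists; first exact: spin_covers_mul (cov _ _ _ _ _ _) (cov _ _ _ _ _ _).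
  rewrite -mulmxA (act X Y) // E mulmxDr -!scalemxAr (act X' (- Y'))// -mulmxA !cl_linear.
  rewrite (cl_swap hc Y' X') (dotC Y') XY' mulr0 scale0r subr0.
  rewrite !cl_sqr// X1' Y1' !scaleN1r !clNr !cl_sqr// X1' !scaleN1r.
  rewrite -[RHS]scale1r -(cos2Dsin2 t); apply/colP => i; rewrite !mxE; ring.
- by rewrite !rot0// mulmx1.
- apply: is_derive_eq (is_derive_mulmx (is_derive_plane_rotation X1' mY' XmY')
    (is_derive_plane_rotation X1 Y1 XY)) _.
  rewrite !rot0// mulmx1 mul1mx addrC -scalerDr; congr (_ *: (_ + _)).
  by rewrite /rotation_generator linearN /= mulmxN mulNmx opprB opprK addrC.
Qed.

(** An element [C] of [m] is orthogonal to the generators of [g2] given by pairs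
    of planes, so [C(X, Y)] depends on the orthonormal pair [X], [Y] through its
    cross product only. *)
Lemma m_g2_same_cross C X Y X' Y' : m_g2 c a C ->
  dot X X = 1 -> dot Y Y = 1 -> dot X Y = 0 ->
  dot X' X' = 1 -> dot Y' Y' = 1 -> dot X' Y' = 0 ->
  X *c Y *c a = X' *c Y' *c a ->
  dot X (C *m Y) = dot X' (C *m Y').
Proof.
move=> [sC hC] X1 Y1 XY X1' Y1' XY' E.
have := hC _ (g2_rotations X1 Y1 XY X1' Y1' XY' E).
have trE U W : \tr ((rotation_generator U W)^T *m C) = - 2 * dot U (C *m W).
  have tr1 U' W' : \tr (U' *m W'^T *m C) = dot W' (C *m U').
    by rewrite -mulmxA mxtrace_mulC /mxtrace big_ord1 -mulmxA -dotE.
  rewrite /rotation_generator linearB /= !trmx_mul !trmxK mulmxBl linearB /= !tr1.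
  have -> : dot W (C *m U) = - dot U (C *m W).
    by rewrite dotC dot_mulmx sC mulNmx dotNr.
  by ring.
rewrite linearZ /= -scalemxAl linearZ /= linearB /= mulmxBl linearB /= !trE; lra.
Qed.

End G2.

(** * The splitting of so(7) into g2 and m *)

Section G2Decomposition.
Context (R : realType) (c : {linear 'cV[R]_7 -> 'M[R]_8}) (hc : clifford_module c).
Context (a : 'cV[R]_8) (a1 : dot a a = 1).
Local Notation "X *c a" := (c X *m a) (at level 35, right associativity).
Local Notation e := (basis7 R).
Implicit Types (X Y Z U W N : 'cV[R]_7) (A B C : 'M[R]_7).
Local Notation T := (three_form c a).

(** For [X'] orthogonal to [N] the spinor [- X' . N . a] is [Y' . a], where [Y']
    is the cross product of [N] and [X']; thus [X'], [Y'] is a multiple of an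
    orthonormal pair with cross product [N]. *)
Lemma m_g2_cross_scaled C X Y N X' : m_g2 c a C ->
  dot X X = 1 -> dot Y Y = 1 -> dot X Y = 0 -> X *c Y *c a = N *c a ->
  dot N X' = 0 ->
  dot X' (C *m spinor_vec c a (- (X' *c N *c a))) = dot X' X' * dot X (C *m Y).
Proof.
move=> hC X1 Y1 XY E NX'.
set Y' := spinor_vec _ _ _.
have Y'a : Y' *c a = - (X' *c N *c a).
  by rewrite spinor_vec_cl// dot_linear cl_skew// cl_dot_vec// NX' mul0r !oppr0.
have [->|X'0] := eqVneq X' 0; first by rewrite !dot_linear mul0r.
have N1 : dot N N = 1.
  have := cl_dot_vec hc N N a; rewrite -E !cl_dot// X1 Y1 a1; lra.
have Y'1 : dot Y' Y' = dot X' X'.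
  have := cl_dot_vec hc Y' Y' a; rewrite Y'a !dot_linear !cl_dot// N1 a1; lra.
have X'Y' : dot X' Y' = 0.
  have := cl_dot_vec hc X' Y' a.
  rewrite Y'a !dot_linear cl_dot// (dotC a) cl_dot_self// a1; lra.
have r0 : Num.sqrt (dot X' X') != 0.
  by rewrite sqrtr_eq0 -ltNge lt_neqAle dot_ge0 eq_sym dot_eq0 X'0.
have r2 : Num.sqrt (dot X' X') ^+ 2 = dot X' X' by rewrite sqr_sqrtr ?dot_ge0.
have := m_g2_same_cross hc hC X1 Y1 XY (unit_normalize X'0).
move: r0 r2; set r := Num.sqrt _ => r0 r2 /(_ (r^-1 *: Y')) ->.
- by rewrite -scalemxAr !dot_linear -r2; field.
- by rewrite !dot_linear Y'1 -r2; field.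
- by rewrite !dot_linear X'Y' !mulr0.
- rewrite !cl_linear Y'a clNr cl_sqr// -r2 E.
  by apply/colP => i; rewrite !mxE; field.
Qed.

Lemma three_form_sum3 X Y Z : T X Y Z = \sum_k T X Y (e k) * Z k 0.
Proof.
rewrite /three_form {1}(basis7_dec Z) linear_sum mulmx_suml dot_sumr.
by apply: eq_bigr => k _; rewrite clZl dotZr mulrC.
Qed.

Lemma three_form_sum1 X Y Z : T X Y Z = \sum_k X k 0 * T (e k) Y Z.
Proof.
rewrite /three_form {1}(basis7_dec X) linear_sum mulmx_suml dot_suml.
by apply: eq_bigr => k _; rewrite clZl dotZl.
Qed.

Lemma three_form_sum2 X Y Z : T X Y Z = \sum_k Y k 0 * T X (e k) Z.
Proof.
rewrite /three_form {1}(basis7_dec Y) linear_sum mulmx_suml mulmx_sumr dot_suml.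
by apply: eq_bigr => k _; rewrite clZl clZr dotZl.
Qed.

(** Let [N] be the cross product of [X] and [Y]. The number [C(X', N x X')] is
    [C(X, Y)] for every unit vector [X'] orthogonal to [N]. Summing over the
    projections of the basis vectors to the complement of [N], which has
    dimension 6, expresses [6 C(X, Y)] as a contraction of [C] with the 3-form. *)
Lemma m_g2_three_form C X Y : m_g2 c a C ->
  dot X X = 1 -> dot Y Y = 1 -> dot X Y = 0 ->
  dot X (C *m Y) = 6^-1 * T X Y (contract_three_form c a C).
Proof.
move=> hC X1 Y1 XY.
pose N := spinor_vec c a (X *c Y *c a).
have Na : N *c a = X *c Y *c a.
  by rewrite spinor_vec_cl// cl_skew// cl_dot_vec// dotC XY mul0r oppr0.
have N1 : dot N N = 1.
  have := cl_dot_vec hc N N a; rewrite Na !cl_dot// X1 Y1 a1; lra.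
pose t p : 'cV[R]_7 := \col_q T (e p) (e q) N.
have tE p : spinor_vec c a (- ((e p - N p 0 *: N) *c N *c a)) = t p.
  apply/colP => q; rewrite !mxE !cl_linear cl_sqr// !dot_linear (dotC a) cl_dot_self//.
  by rewrite cl_skew// /three_form dotC; ring.
have orth p : dot N (e p - N p 0 *: N) = 0.
  by rewrite !dot_linear dot_basisr N1 mulr1 subrr.
have E p := m_g2_cross_scaled hC X1 Y1 XY (esym Na) (orth p).
have sq p : dot (e p - N p 0 *: N) (e p - N p 0 *: N) = 1 - N p 0 * N p 0.
  have ee : dot (e p) (e p) = 1 by rewrite dot_basisl mxE !eqxx.
  by rewrite !dot_linear N1 ee dot_basisl dot_basisr; ring.
(* On the complement of N the sum of the squared lengths is 7 - |N|^2 = 6. *)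
have S1 : \sum_p dot (e p - N p 0 *: N) (C *m t p) = 6 * dot X (C *m Y).
  under eq_bigr => p _ do rewrite -tE E sq.
  rewrite -mulr_suml sumrB sumr_const card_ord -/(dot N N) N1; congr (_ * _).
  by ring.
have S2 : \sum_p N p 0 *: t p = 0.
  apply/colP => q; rewrite summxE mxE.
  transitivity (T N (e q) N).
    by rewrite three_form_sum1; apply: eq_bigr => p _; rewrite !mxE.
  by rewrite /three_form cl_dot// cl_dot_self// mulr0.
have S3 : \sum_p dot (e p) (C *m t p) = T X Y (contract_three_form c a C).
  under eq_bigr => p _ do rewrite dot_basisl.
  rewrite /three_form -Na cl_dot_vec// a1 mulr1 dotC /dot.
  under [RHS]eq_bigr => k _ do rewrite mxE mulr_suml.
  rewrite exchange_big; apply: eq_bigr => p _ /=.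
  rewrite mxE.
  under [RHS]eq_bigr => k _ do rewrite mulr_suml.
  rewrite exchange_big; apply: eq_bigr => q _ /=.
  rewrite mxE three_form_sum3 mulr_sumr; apply: eq_bigr => k _.
  by rewrite mulrA.
have : \sum_p dot (e p - N p 0 *: N) (C *m t p) =
   T X Y (contract_three_form c a C) - dot N (C *m \sum_p N p 0 *: t p).
  rewrite -S3 mulmx_sumr dot_sumr -sumrB; apply: eq_bigr => p _.
  by rewrite -scalemxAr !dot_linear.
rewrite S1 S2 mulmx0 dot0r; lra.
Qed.

Lemma m_g2_entry C i j : m_g2 c a C ->
  C i j = 6^-1 * T (e i) (e j) (contract_three_form c a C).
Proof.
move=> hC; have bE k l : dot (e k) (e l) = (k == l)%:R.
  by rewrite dot_basisl mxE eqxx andbT.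
have -> : C i j = dot (e i) (C *m e j) by rewrite dot_basisl -colE mxE.
have [<-|ij] := eqVneq i j; last first.
  by apply: m_g2_three_form; rewrite ?bE ?eqxx ?(negPf ij).
rewrite dot_basisl -colE mxE.
have := so7P i i hC.1.
rewrite /three_form cl_sqr// bE eqxx dotZl (dotC a) cl_dot_self//; lra.
Qed.

(** If [B + C] changes the 3-form by the same amount as moving the spinor along
    [- W . a], then [C] must act on [a] as [W], because [B] has no effect on the
    3-form and the 4-form is non-degenerate. The factor [- 2/3] is the quotient of
    [1/6] in [m_g2_entry] by [-1/4] in [spin_rep_vec]. *)
Lemma m_g2_of_three_form_derivative B C W : lie_g2 c a B -> m_g2 c a C ->
  (forall X Y Z, T ((B + C) *m X) Y Z + T X ((B + C) *m Y) Z
     + T X Y ((B + C) *m Z) + four_form c a X Y Z W = 0) ->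
  forall i j, C i j = - (2 / 3) * T (e i) (e j) W.
Proof.
move=> hB hC h i j; rewrite m_g2_entry//.
suff -> : W = - 4^-1 *: contract_three_form c a C.
  by rewrite /three_form clZl dotZr; field.
apply/eqP; rewrite -subr_eq0; apply/eqP; apply: (four_form_nondeg hc a1) => X Y Z.
rewrite four_formB.
have hb := lie_g2_three_form hc X Y Z hB.
have := three_form_so7 hc a X Y Z hC.1.
rewrite (spin_rep_vec hc a1 hC.1) -/(four_form c a X Y Z _).
have := h X Y Z; rewrite !mulmxDl.
have := three_form_lin1 c a 1 (B *m X) (C *m X) Y Z.
have := three_form_lin2 c a 1 (B *m Y) (C *m Y) X Z.
have := three_form_lin3 c a 1 (B *m Z) (C *m Z) X Y.
rewrite !scale1r; lra.
Qed.

End G2Decomposition.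

(** * Closure properties of smooth functions *)

Section Smooth.
Context (R : realType).
Local Notation E7 := 'cV[R]_7.
Implicit Types (U : set E7) (f g : E7 -> R) (k : nat).

(** Differentiability is defined through a chosen differential; the differential
    of [f] satisfies the first-order expansion of [g], and by uniqueness it is
    the one chosen for [g]. *)
Lemma near_eq_differentiable (V W : normedModType R) (f g : V -> W) x :
  (\forall y \near x, f y = g y) -> differentiable f x -> differentiable g x.
Proof.
move=> fg dfx; have [dfc /eqaddoP df] := (diff_locallyP _ _).1 dfx.
have gE : g \o shift x = cst (g x) + 'd f x +o_ 0 id.
  apply/eqaddoP => eps eps0; have := df _ eps0.
  have fg0 : \forall h \near (0 : V), f (h + x) = g (h + x).
    by move: fg; rewrite (near_shift 0 x) /= subr0.
  apply: filterS2 fg0 => h /= fgh.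
  by rewrite !fctE /= fgh (nbhs_singleton fg).
by apply/diff_locallyP; rewrite (diff_unique dfc gE).
Qed.

Lemma Ck_sub (V : normedModType R) k U U' (f : E7 -> V) :
  U `<=` U' -> Ck k U' f -> Ck k U f.
Proof.
move=> UU'; elim: k f => [|k IH] f /= h; first by move=> p /UU'/h.
by split=> [p /UU'/h.1|v]; [|exact: IH (h.2 v)].
Qed.

(** As the iterated derivatives at a point of an open set depend only on the germ,
    the values outside are irrelevant. The closure properties below use it to
    replace derivatives by the expressions that the rules of calculus give. *)
Lemma Ck_eq (V : normedModType R) k U (f g : E7 -> V) : open U ->
  (forall p, U p -> f p = g p) -> Ck k U f -> Ck k U g.
Proof.
move=> oU; elim: k f g => [|k IH] f g fg /=.
  move=> h p Up; have nfg : \forall q \near p, f q = g q.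
    by near=> q; apply: fg; near: q; exact: open_nbhs_nbhs.
  change (g @ p --> g p); rewrite -(fg _ Up).
  by apply: cvg_trans (h p Up); exact: near_eq_cvg nfg.
have nfg p : U p -> \forall q \near p, f q = g q.
  by move=> Up; near=> q; apply: fg; near: q; exact: open_nbhs_nbhs.
move=> [h1 h2]; split.
  by move=> p Up; exact: near_eq_differentiable (nfg _ Up) (h1 p Up).
move=> v; apply: IH (h2 v) => p Up; apply: near_eq_derive; exact: nfg.
Unshelve. all: by end_near.
Qed.

Lemma CkW (V : normedModType R) k U (f : E7 -> V) : Ck k.+1 U f -> Ck k U f.
Proof.
elim: k f => [|k IH] f [h1 h2].
  by move=> p Up; exact: differentiable_continuous (h1 p Up).
by split=> // v; exact: IH (h2 v).
Qed.

Lemma Ck_cst (V : normedModType R) k U (w : V) : open U -> Ck k U (fun=> w).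
Proof.
move=> oU; elim: k w => [|k IH] w /=.
  by move=> p _; exact: (@cst_continuous _ _ w p).
split=> [p _|v]; first exact: differentiable_cst.
by apply: Ck_eq (IH 0) => // p _; exact/esym/derive_cst.
Qed.

Lemma Ck_add (V : normedModType R) k U (f g : E7 -> V) : open U ->
  Ck k U f -> Ck k U g -> Ck k U (fun y => f y + g y).
Proof.
move=> oU; elim: k f g => [|k IH] f g /= hf hg.
  by move=> p Up; exact: cvgD (hf p Up) (hg p Up).
split=> [p Up|v]; first exact: differentiableD (hf.1 p Up) (hg.1 p Up).
apply: Ck_eq (IH _ _ (hf.2 v) (hg.2 v)) => // p Up.
by rewrite [RHS]deriveD//; apply: diff_derivable; [exact: hf.1|exact: hg.1].
Qed.

Lemma Ck_sum (V : normedModType R) k U I (r : seq I) (f : I -> E7 -> V) : open U ->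
  (forall i, Ck k U (f i)) -> Ck k U (fun y => \sum_(i <- r) f i y).
Proof.
move=> oU hf; elim: r => [|i r IH].
  by apply: Ck_eq (Ck_cst k 0 oU) => // p _; rewrite big_nil.
by apply: Ck_eq (Ck_add oU (hf i) IH) => // p _; rewrite big_cons.
Qed.

Lemma Ck_mul k U f g : open U ->
  Ck k U f -> Ck k U g -> Ck k U (fun y => f y * g y).
Proof.
move=> oU; elim: k f g => [|k IH] f g hf hg.
  by move=> p Up; exact: cvgM (hf p Up) (hg p Up).
split=> [p Up|v]; first exact: differentiableM (hf.1 p Up) (hg.1 p Up).
have := Ck_add oU (IH _ _ (CkW hf) (hg.2 v)) (IH _ _ (CkW hg) (hf.2 v)).
apply: Ck_eq => // p Up.
by rewrite [RHS]deriveM//; apply: diff_derivable; [exact: hf.1|exact: hg.1].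
Qed.

Lemma Ck_inv k U f : open U -> (forall p, U p -> f p != 0) ->
  Ck k U f -> Ck k U (fun y => (f y)^-1).
Proof.
move=> oU f0; elim: k f f0 => [|k IH] f f0 hf.
  by move=> p Up; exact: cvgV (f0 _ Up) (hf p Up).
split=> [p Up|v]; first exact: differentiableV (hf.1 p Up) (f0 p Up).
have hV := IH _ f0 (CkW hf).
have := Ck_mul oU (Ck_mul oU (Ck_cst k (-1 : R) oU) (Ck_mul oU hV hV)) (hf.2 v).
apply: Ck_eq => // p Up.
rewrite [RHS]deriveV ?f0//; last exact/diff_derivable/hf.1.
by rewrite -exprVn expr2 mulN1r.
Qed.

Lemma Ck_mxP m n k U (F : E7 -> 'M[R]_(m, n)) : open U ->
  Ck k U F <-> forall i j, Ck k U (fun y => F y i j).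
Proof.
move=> oU; elim: k F => [|k IH] F; split.
- move=> h i j p Up; exact: (continuous_comp (h p Up) (@coord_continuous _ _ _ _ _ _)).
- move=> h; have E : F = fun y => \sum_i \sum_j F y i j *: delta_mx i j.
    by apply/funext => y; exact: matrix_sum_delta.
  rewrite {}E; apply: Ck_sum => // i; apply: Ck_sum => // j p Up.
  have hp : F q i j @[q --> p] --> F p i j := h i j p Up.
  exact: (@cvgZr_tmp _ _ _ _ _ _ _ (delta_mx i j) hp).
- move=> [h1 h2] i j; split=> [p Up|v].
    exact: (differentiable_comp (h1 p Up) (differentiable_coord _ i j)).
  apply: Ck_eq ((IH _).1 (h2 v) i j) => // p Up.
  by rewrite derive_mx ?mxE//; apply/diff_derivable/h1.
- move=> h; have dF p : U p -> differentiable F p.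
    move=> Up.
    have -> : F = \sum_i \sum_j (fun y => F y i j *: delta_mx i j).
      apply/funext => y; rewrite fct_sumE [LHS]matrix_sum_delta.
      by apply: eq_bigr => i _; rewrite fct_sumE.
    apply: differentiable_sum => i; apply: differentiable_sum => j.
    apply: differentiableZl; exact: (h i j).1.
  split=> // v; apply/IH => i j; apply: Ck_eq ((h i j).2 v) => // p Up.
  by rewrite derive_mx ?mxE//; apply/diff_derivable/dF.
Qed.

End Smooth.

(** * Smooth functions and vector fields on a manifold *)

Section ManifoldCalculus.
Context (R : realType) (M : manifold R).
Implicit Types (U : set M) (x y : M) (v : 'cV[R]_7).

Lemma open_chart_image U a : open U -> open (chart a @` (U `&` chart_dom a)).
Proof.
move=> oU; rewrite openE => p [y [Uy ay] <-{p}].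
have py : (chart a @` chart_dom a) (chart a y) by exists y.
have n1 : nbhs (chart a y) (chart a @` chart_dom a).
  by apply: open_nbhs_nbhs; split => //; exact: chart_open.
have n2 : nbhs (chart a y) (chart_inv a @^-1` U).
  apply: (chart_inv_continuous py); rewrite chartK//.
  exact: open_nbhs_nbhs.
apply: filterS2 n1 n2 => q [z az <-]; rewrite /= chartK// => Uz.
by exists z.
Qed.

Lemma chart_image_inv U a p : (chart a @` (U `&` chart_dom a)) p ->
  U (chart_inv a p) /\ chart_dom a (chart_inv a p).
Proof. by move=> [y [Uy ay] <-]; rewrite chartK. Qed.

Lemma msmooth_sub (V : normedModType R) U U' (f : M -> V) :
  U `<=` U' -> msmooth U' f -> msmooth U f.
Proof.
by move=> UU' h a k; apply: Ck_sub (h a k); apply: image_subset; apply: setSI.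
Qed.

Lemma msmooth_eq (V : normedModType R) U (f g : M -> V) : open U ->
  (forall y, U y -> f y = g y) -> msmooth U f -> msmooth U g.
Proof.
move=> oU fg h a k; apply: Ck_eq (h a k); first exact: open_chart_image.
by move=> p /chart_image_inv[Up _] /=; exact: fg.
Qed.

Lemma msmooth_cst (V : normedModType R) U (w : V) : open U -> msmooth U (fun=> w).
Proof. by move=> oU a k; apply: Ck_cst; exact: open_chart_image. Qed.

Lemma msmooth_add (V : normedModType R) U (f g : M -> V) : open U ->
  msmooth U f -> msmooth U g -> msmooth U (fun y => f y + g y).
Proof.
move=> oU hf hg a k; apply: Ck_add (hf a k) (hg a k); exact: open_chart_image.
Qed.

Lemma msmooth_mul U (f g : M -> R) : open U ->
  msmooth U f -> msmooth U g -> msmooth U (fun y => f y * g y).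
Proof.
move=> oU hf hg a k; apply: Ck_mul (hf a k) (hg a k); exact: open_chart_image.
Qed.

Lemma msmooth_inv U (f : M -> R) : open U -> (forall y, U y -> f y != 0) ->
  msmooth U f -> msmooth U (fun y => (f y)^-1).
Proof.
move=> oU f0 hf a k; apply: Ck_inv (hf a k); first exact: open_chart_image.
by move=> p /chart_image_inv[Up _]; exact: f0.
Qed.

Lemma msmooth_sum U I (r : seq I) (f : I -> M -> R) : open U ->
  (forall i, msmooth U (f i)) -> msmooth U (fun y => \sum_(i <- r) f i y).
Proof.
move=> oU h a k; apply: (@Ck_sum _ _ _ _ _ _ (fun i => f i \o chart_inv a)).
  exact: open_chart_image.
by move=> i; exact: h.
Qed.

Lemma msmooth_mxP m n U (F : M -> 'M[R]_(m, n)) : open U ->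
  msmooth U F <-> forall i j, msmooth U (fun y => F y i j).
Proof.
move=> oU; split=> [h i j a k|h a k].
  by apply: (Ck_mxP k (F \o chart_inv a) _).1; [exact: open_chart_image | exact: h].
apply/Ck_mxP => [|i j]; first exact: open_chart_image.
exact: h.
Qed.

Lemma is_mderiv (V : normedModType R) U (f : M -> V) x v : open U -> U x ->
  msmooth U f -> is_derive (chart x x) v (f \o chart_inv x) (mderiv f x v).
Proof.
move=> oU Ux h; apply: derivableP; apply: diff_derivable.
by apply: (h x 1%N).1; exists x => //; split => //; exact: chart_dom_mem.
Qed.

(** A derivative at a point of an open set [U] depends only on the values on [U]. *)
Lemma mderiv_eq (V : normedModType R) U (f g : M -> V) x v : open U -> U x ->
  (forall y, U y -> f y = g y) -> mderiv f x v = mderiv g x v.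
Proof.
move=> oU Ux fg; apply: near_eq_derive.
have : nbhs (chart x x) (chart x @` (U `&` chart_dom x)).
  apply: open_nbhs_nbhs; split; first exact: open_chart_image.
  by exists x => //; split => //; exact: chart_dom_mem.
by apply: filterS => p /chart_image_inv[Up _] /=; exact: fg.
Qed.

Lemma mderiv_const (V : normedModType R) (w : V) x v : mderiv (fun=> w) x v = 0.
Proof. exact: derive_cst. Qed.

Lemma mderiv_chart_sum b y I (r : seq I) (a : I -> R) (X : I -> 'cV[R]_7) :
  chart_dom b y -> mderiv (chart b) y (\sum_(i <- r) a i *: X i) =
  \sum_(i <- r) a i *: mderiv (chart b) y (X i).
Proof.
move=> yb; have d : differentiable (chart b \o chart_inv y) (chart y y).
  apply: (chart_smooth y b 1%N).1; exists y => //; split => //; exact: chart_dom_mem.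
rewrite /mderiv deriveE// linear_sum; apply: eq_bigr => i _.
by rewrite linearZ deriveE.
Qed.

Lemma vfield_sub U U' (X : M -> 'cV[R]_7) : U `<=` U' -> vfield U' X -> vfield U X.
Proof. by move=> UU' h b; apply: msmooth_sub (h b); exact: setSI. Qed.

Lemma vfield_eq U (X Y : M -> 'cV[R]_7) : open U ->
  (forall y, U y -> X y = Y y) -> vfield U X -> vfield U Y.
Proof.
move=> oU XY h b; apply: msmooth_eq (h b).
  by apply: openI => //; exact: chart_dom_open.
by move=> y [Uy _]; rewrite XY.
Qed.

(** Being a vector field is tested in all charts, and the change of coordinates
    of tangent vectors is linear at each point. *)
Lemma vfield_sum U I (r : seq I) (a : I -> M -> R) (X : I -> M -> 'cV[R]_7) :
  open U -> (forall i, msmooth U (a i)) -> (forall i, vfield U (X i)) ->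
  vfield U (fun y => \sum_(i <- r) a i y *: X i y).
Proof.
move=> oU ha hX b; have oUb : open (U `&` chart_dom b).
  by apply: openI => //; exact: chart_dom_open.
apply: (@msmooth_eq _ _
  (fun y => \sum_(i <- r) a i y *: mderiv (chart b) y (X i y))) => //.
  by move=> y [_ yb]; rewrite mderiv_chart_sum.
apply/msmooth_mxP => // k l.
have : msmooth (U `&` chart_dom b)
    (fun y => \sum_(i <- r) a i y * mderiv (chart b) y (X i y) k l).
  apply: msmooth_sum => // i; apply: msmooth_mul => //.
    by apply: msmooth_sub (ha i) => y [].
  exact: (msmooth_mxP _ oUb).1 (hX i b) k l.
apply: msmooth_eq => // y _; rewrite summxE; apply: eq_bigr => i _.
by rewrite mxE.
Qed.

Lemma vfield_scale U k (X : M -> 'cV[R]_7) : open U -> vfield U X ->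
  vfield U (fun y => k *: X y).
Proof.
move=> oU hX; have := vfield_sum [:: tt] (a := fun _ _ => k) oU
  (fun=> msmooth_cst k oU) (fun=> hX).
by apply: vfield_eq => // y _; rewrite big_seq1.
Qed.

Lemma connection_sum (nabla : cov_deriv M) U x v I (r : seq I) (a : I -> R)
    (X : I -> M -> 'cV[R]_7) : connection nabla -> open U -> U x ->
  (forall i, vfield U (X i)) ->
  nabla x v (fun y => \sum_(i <- r) a i *: X i y)
  = \sum_(i <- r) a i *: nabla x v (X i).
Proof.
move=> hn oU Ux hX.
have hZ k Y : vfield U Y -> nabla x v (fun y => k *: Y y) = k *: nabla x v Y.
  move=> hY; rewrite (nabla_leibniz hn (f := fun=> k) v oU _ hY Ux).
    by rewrite mderiv_const scale0r add0r.
  exact: msmooth_cst.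
have hr s : vfield U (fun y => \sum_(i <- s) a i *: X i y).
  by apply: (vfield_sum _ (a := fun i _ => a i)) => // i; exact: msmooth_cst.
elim: r => [|i r IH].
  have -> : (fun y => \sum_(i <- [::]) a i *: X i y) =
      fun y => 0 *: (fun y => \sum_(i <- [::]) a i *: X i y) y.
    by apply/funext => y; rewrite scale0r big_nil.
  by rewrite hZ// scale0r big_nil.
have -> : (fun y => \sum_(i <- i :: r) a i *: X i y) =
    fun y => a i *: X i y + \sum_(i <- r) a i *: X i y.
  by apply/funext => y; rewrite big_cons.
by rewrite (nabla_add hn v oU (vfield_scale _ oU (hX i)) (hr r) Ux) hZ// IH big_cons.
Qed.

End ManifoldCalculus.

(** * Smooth matrices, transitivity of Spin(7), orthonormal frames *)

Section SmoothMatrices.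
Context (R : realType) (M : manifold R).
Implicit Types (U : set M).

Lemma msmooth_mulmx m n p U (F : M -> 'M[R]_(m, n)) (G : M -> 'M[R]_(n, p)) :
  open U -> msmooth U F -> msmooth U G -> msmooth U (fun y => F y *m G y).
Proof.
move=> oU /msmooth_mxP hF /msmooth_mxP hG; apply/msmooth_mxP => // i j.
have : msmooth U (fun y => \sum_k F y i k * G y k j).
  by apply: msmooth_sum => // k; apply: msmooth_mul => //; [exact: hF|exact: hG].
by apply: msmooth_eq => // y _; rewrite mxE.
Qed.

Lemma msmooth_tr m n U (F : M -> 'M[R]_(m, n)) :
  open U -> msmooth U F -> msmooth U (fun y => (F y)^T).
Proof.
move=> oU /msmooth_mxP hF; apply/msmooth_mxP => // i j.
by apply: msmooth_eq (hF oU j i) => // y _; rewrite mxE.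
Qed.

Lemma msmooth_dot n U (F G : M -> 'cV[R]_n) :
  open U -> msmooth U F -> msmooth U G -> msmooth U (fun y => dot (F y) (G y)).
Proof.
move=> oU hF hG.
have := (msmooth_mxP _ oU).1 (msmooth_mulmx oU (msmooth_tr oU hF) hG) 0 0.
by apply: msmooth_eq => // y _; rewrite dotE.
Qed.

Lemma msmooth_scale m n U (f : M -> R) (F : M -> 'M[R]_(m, n)) :
  open U -> msmooth U f -> msmooth U F -> msmooth U (fun y => f y *: F y).
Proof.
move=> oU hf /msmooth_mxP hF; apply/msmooth_mxP => // i j.
by apply: msmooth_eq (msmooth_mul oU hf (hF oU i j)) => // y _; rewrite mxE.
Qed.

Lemma msmooth_linear m n p U (L : {linear 'cV[R]_p -> 'M[R]_(m, n)}) F :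
  open U -> msmooth U F -> msmooth U (fun y => L (F y)).
Proof.
move=> oU /msmooth_mxP hF; apply/msmooth_mxP => // i j.
have : msmooth U (fun y => \sum_k F y k 0 * L (delta_mx k 0) i j).
  apply: msmooth_sum => // k; apply: msmooth_mul => //; first exact: hF.
  exact: msmooth_cst.
apply: msmooth_eq => // y _; rewrite [in RHS](matrix_sum_delta (F y)).
rewrite linear_sum summxE; apply: eq_bigr => k _.
by rewrite big_ord1 linearZ mxE.
Qed.

Lemma msmooth_reflection U (F : M -> 'cV[R]_7) : open U ->
  (forall y, U y -> F y != 0) -> msmooth U F ->
  msmooth U (fun y => reflection (F y)).
Proof.
move=> oU F0 hF; apply: msmooth_add => //; first exact: msmooth_cst.
have hV : msmooth U (fun y => (dot (F y) (F y))^-1).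
  by apply: msmooth_inv (msmooth_dot oU hF hF) => // y Uy; rewrite dot_eq0 F0.
have := msmooth_scale oU (msmooth_mul oU (msmooth_cst (-2 : R) oU) hV)
   (msmooth_mulmx oU hF (msmooth_tr oU hF)).
by apply: msmooth_eq => // y _; rewrite mulNr scaleNr.
Qed.

(** Smooth functions are continuous for the topology of the manifold. *)
Lemma open_neq0 U (f : M -> R) : open U -> msmooth U f ->
  open (U `&` [set y | f y != 0]).
Proof.
move=> oU hf; rewrite openE => y [Uy fy].
have cf : {for chart y y, continuous (f \o chart_inv y)}.
  by apply: (hf y 0%N); exists y => //; split => //; exact: chart_dom_mem.
have f0 : nbhs (f y) [set t : R | t != 0].
  by apply: open_nbhs_nbhs; split => //; exact: open_neq.
have n1 : nbhs (chart y y) [set p | f (chart_inv y p) != 0].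
  have cf' : (f \o chart_inv y) p @[p --> chart y y] --> f y.
    have := cf; rewrite /prop_for /continuous_at /= (chartK (chart_dom_mem y)); exact.
  exact: cf' f0.
have n2 := chart_continuous (chart_dom_mem y) n1.
have n3 : nbhs y (chart_dom y).
  by apply: open_nbhs_nbhs; split; [exact: chart_dom_open|exact: chart_dom_mem].
have n4 : nbhs y U by exact: open_nbhs_nbhs.
by near=> z; split; [near: z | rewrite /= -(@chartK _ _ y z); near: z].
Unshelve. all: by end_near.
Qed.

End SmoothMatrices.

Section SpinTransitive.
Context (R : realType) (c : {linear 'cV[R]_7 -> 'M[R]_8}) (hc : clifford_module c).
Local Notation "X *c a" := (c X *m a) (at level 35, right associativity).
Local Notation e := (basis7 R).
Implicit Types (a b : 'cV[R]_8) (X Y Z U W N : 'cV[R]_7) (A B C : 'M[R]_7).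

(** The Clifford action determines the inner product of vectors, so the elements
    covered by Spin(7) are orthogonal. *)
Lemma covers_dot h A X Y : spin_covers c h A -> dot (A *m X) (A *m Y) = dot X Y.
Proof.
move=> [hh hA]; pose a : 'cV[R]_8 := delta_mx 0 0.
have a1 : dot a a = 1.
  rewrite /dot (bigD1 0) //= big1 => [|i /negPf i0]; rewrite !mxE ?eqxx ?i0 ?mulr0//.
  by rewrite mulr1 addr0.
have h1 : dot (h *m a) (h *m a) = 1 by rewrite (spin7_dot hc _ _ hh).
have := cl_dot_vec hc (A *m X) (A *m Y) (h *m a).
rewrite h1 !mulmxA -!hA -!mulmxA (spin7_dot hc _ _ hh) cl_dot_vec// a1; lra.
Qed.

(** The vector [W] solves [W . U . a = |U|^2 b], which is possible because [b] is
    orthogonal to [U . a]; normalizing [U] and [W] yields an element of Spin(7)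
    that sends [a] to [b]. *)
Lemma two_vectors_act a b U : dot a a = 1 -> dot b b = 1 -> U != 0 ->
  dot b (U *c a) = 0 ->
  spinor_vec c (U *c a) b != 0 /\
  exists2 h, spin_covers c h (reflection (spinor_vec c (U *c a) b) *m reflection U)
    & h *m a = b.
Proof.
move=> a1 b1 U0 bU; set W := spinor_vec _ _ _.
pose r := Num.sqrt (dot U U).
have r0 : r != 0 by rewrite sqrtr_eq0 -ltNge lt_neqAle dot_ge0 eq_sym dot_eq0 U0.
have rV0 : r^-1 != 0 by rewrite invr_eq0.
have U1 : dot (r^-1 *: U) (r^-1 *: U) = 1 by exact: unit_normalize.
pose a' := (r^-1 *: U) *c a.
have a'1 : dot a' a' = 1 by rewrite cl_dot// U1 a1 mulr1.
have W' : spinor_vec c a' b = r^-1 *: W.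
  by apply/colP => i; rewrite !mxE /a' clZl clZr dotZr.
have Wb : (r^-1 *: W) *c a' = b.
  by rewrite -W' spinor_vec_cl// /a' clZl dotZr bU mulr0.
have W1 : dot (r^-1 *: W) (r^-1 *: W) = 1.
  by rewrite -[LHS]mulr1 -{1}a'1 -(cl_dot_vec hc) Wb.
split; first by apply: contra_eq_neq W1 => ->; rewrite scaler0 dot0l eq_sym oner_neq0.
exists (c (r^-1 *: W) *m c (r^-1 *: U)); last by rewrite -mulmxA.
rewrite -(reflectionZ W rV0) -(reflectionZ U rV0); exact: covers_reflections.
Qed.

(** It suffices to choose a vector [U] with [U . a] orthogonal to [b]. *)
Lemma spin7_transitive a b : dot a a = 1 -> dot b b = 1 ->
  exists h A, spin_covers c h A /\ h *m a = b.
Proof.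
move=> a1 b1; have [U U0 [h _ _]] := exists_orthogonal3 (spinor_vec c a b) 0 0.
rewrite spinor_vecP in h.
have [_ [k hk kab]] := two_vectors_act a1 b1 U0 h.
by exists k; eexists; split; first exact: hk.
Qed.

End SpinTransitive.

Section Metric.
Context (R : realType) (M : manifold R) (g : metric M).
Implicit Types (y : M) (v w : 'cV[R]_7).

Lemma g_scalel y k v w : g y (k *: v) w = k * g y v w.
Proof.
have g0 : g y 0 w = 0 by have := g_lin g y 1 0 0 w; rewrite scaler0 addr0; lra.
by have := g_lin g y k v 0 w; rewrite addr0 g0 addr0.
Qed.

Lemma g_suml y I (r : seq I) (F : I -> 'cV[R]_7) w :
  g y (\sum_(i <- r) F i) w = \sum_(i <- r) g y (F i) w.
Proof.
elim: r => [|i r IH]; first by rewrite !big_nil -(scale0r 0) g_scalel mul0r.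
by rewrite !big_cons -IH -[F i in LHS]scale1r g_lin mul1r.
Qed.

Lemma frame_dot y (E : 'M[R]_7) v w :
  (forall i j, g y (col i E) (col j E) = (i == j)%:R) ->
  g y (E *m v) (E *m w) = dot v w.
Proof.
move=> hE; have decE u : E *m u = \sum_i u i 0 *: col i E.
  rewrite {1}(basis7_dec u) mulmx_sumr; apply: eq_bigr => i _.
  by rewrite -scalemxAr -colE.
rewrite !decE g_suml; apply: eq_bigr => i _; rewrite g_scalel; congr (_ * _).
rewrite g_sym g_suml (bigD1 i) //= big1 => [|j ji].
  by rewrite g_scalel hE eqxx mulr1 addr0.
by rewrite g_scalel hE (negPf ji) mulr0.
Qed.

End Metric.

(** * The three-form of a spinor field in a spin frame *)

Section SpinFrame.
Context (R : realType) (c : {linear 'cV[R]_7 -> 'M[R]_8}) (hc : clifford_module c).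
Context (M : manifold R) (g : metric M) (Q : spin_structure c g).
Context (nabla : cov_deriv M) (hnabla : levi_civita g nabla).
Context (phi : spinor_components Q) (hphi : unit_spinor_field phi).
Context (S : M -> 'M[R]_7) (hSphi : spinor_endo nabla phi S).
Context (a : spin_idx Q).
Local Notation D := (spin_dom a).
Local Notation f := (spin_frame a).
Local Notation e := (basis7 R).
Implicit Types (U : set M) (x y : M) (v w X Y Z : 'cV[R]_7).

(** The coordinates of a tangent vector in the spin frame; the frame being
    orthonormal, they identify the tangent space isometrically with [R^7]. *)
Definition frame_coord y v : 'cV[R]_7 := invmx (f y) *m v.
Local Notation hat := frame_coord.

Lemma spin_frame_unit y : D y -> f y \in unitmx.
Proof. by move=> Dy; rewrite unitmxE unitfE gt_eqF// spin_frame_oriented. Qed.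

Lemma frame_coordK y v : D y -> f y *m hat y v = v.
Proof. by move=> Dy; rewrite /frame_coord mulKVmx// spin_frame_unit. Qed.

Lemma frame_coord_mul y v : D y -> hat y (f y *m v) = v.
Proof. by move=> Dy; rewrite /frame_coord mulKmx// spin_frame_unit. Qed.

Lemma frame_coordB y v w : hat y (v - w) = hat y v - hat y w.
Proof. exact: mulmxBr. Qed.

Lemma frame_coord_sum y I (r : seq I) (F : I -> 'cV[R]_7) :
  hat y (\sum_(i <- r) F i) = \sum_(i <- r) hat y (F i).
Proof. exact: mulmx_sumr. Qed.

Lemma g_frame_coord y v w : D y -> g y v w = dot (hat y v) (hat y w).
Proof.
move=> Dy; rewrite -{1}(frame_coordK v Dy) -{1}(frame_coordK w Dy).
apply: frame_dot => i j.
by have [_ h] := spin_frame_orthonormal a; exact: h.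
Qed.

Lemma frame_coord_fr y i : D y -> hat y (fr f i y) = e i.
Proof. by move=> Dy; rewrite /fr colE frame_coord_mul. Qed.

Lemma g_fr y v i : D y -> g y v (fr f i y) = hat y v i 0.
Proof. by move=> Dy; rewrite g_frame_coord// frame_coord_fr// dot_basisr. Qed.

Lemma vfield_fr U i : U `<=` D -> vfield U (fr f i).
Proof.
by move=> UD; apply: vfield_sub UD _; have [h _] := spin_frame_orthonormal a; exact: h.
Qed.

Section At.
Context (U : set M) (oU : open U) (UD : U `<=` D) (x : M) (Ux : U x) (v : 'cV[R]_7).
Local Notation omega := (conn_form g nabla f x v).

Lemma conn_form_so7 : so7 omega.
Proof.
apply/matrixP => i j; rewrite !mxE.
have := lc_metric hnabla v oU (vfield_fr i UD) (vfield_fr j UD) Ux.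
rewrite (mderiv_eq (g := fun=> (i == j)%:R : R) v oU Ux); last first.
  by move=> y Uy; have [_ h] := spin_frame_orthonormal a; apply: h; exact: UD.
rewrite mderiv_const (g_sym g x (fr f i x)); lra.
Qed.

Lemma msmooth_frame_coord (X : M -> 'cV[R]_7) :
  vfield U X -> msmooth U (fun y => hat y (X y)).
Proof.
move=> hX; apply/msmooth_mxP => // i j.
apply: msmooth_eq (g_smooth g oU hX (vfield_fr i UD)) => // y /UD Dy.
by rewrite g_fr// ord1.
Qed.

(** This is [d(X^i) = (nabla X)^i - sum_j omega_ij X^j]. *)
Lemma is_derive_frame_coord (X : M -> 'cV[R]_7) : vfield U X ->
  is_derive (chart x x) v ((fun y => hat y (X y)) \o chart_inv x)
    (hat x (nabla x v X) - omega *m hat x (X x)).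
Proof.
move=> hX; have hh := msmooth_frame_coord hX.
apply: is_derive_eq (is_mderiv v oU Ux hh) _.
have [dd _] := is_mderiv v oU Ux hh.
apply/colP => i; rewrite /mderiv derive_mx// mxE.
transitivity (mderiv (fun y => g y (X y) (fr f i y)) x v).
  rewrite -[LHS]/(mderiv (fun y => hat y (X y) i 0) x v); apply: (mderiv_eq v oU Ux).
  by move=> y /UD Dy; rewrite g_fr.
rewrite (lc_metric hnabla v oU hX (vfield_fr i UD) Ux).
have Dx := UD Ux.
rewrite g_fr// g_frame_coord// [RHS]mxE; congr (_ + _).
rewrite [RHS]mxE mxE -sumrN; apply: eq_bigr => j _.
by rewrite (so7P i j conn_form_so7) [omega j i]mxE g_fr// mulNr opprK mulrC.
Qed.

Lemma mderiv_phi : mderiv (phi a) x v =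
  c (hat x (S x *m v)) *m phi a x - spin_rep c omega *m phi a x.
Proof.
have Dx := UD Ux; have := hSphi v Dx; rewrite /clifford_mul -/(hat _ _) => <-.
rewrite /spin_nabla spin_repE -[LHS](addrK (4^-1 *: \sum_i \sum_j
    omega j i *: (c (e i) *m (c (e j) *m phi a x)))); congr (_ + _ - _).
congr (_ *: _); apply: eq_bigr => i _; apply: eq_bigr => j _.
by rewrite mxE mulmxA.
Qed.

Definition spinor_form y X Y Z := three_form c (phi a y) (hat y X) (hat y Y) (hat y Z).

(** In the spin frame, the derivatives of the coordinates and of the spinor differ
    from the covariant ones by the action of the connection form, and these
    corrections cancel by [three_form_so7]. What is left of the derivative of the
    spinor is [S v . phi], which contributes the 4-form. *)
Lemma mderiv_spinor_form (X Y Z : M -> 'cV[R]_7) :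
  vfield U X -> vfield U Y -> vfield U Z ->
  mderiv (fun y => spinor_form y (X y) (Y y) (Z y)) x v =
  spinor_form x (nabla x v X) (Y x) (Z x) + spinor_form x (X x) (nabla x v Y) (Z x)
  + spinor_form x (X x) (Y x) (nabla x v Z)
  + four_form c (phi a x) (hat x (X x)) (hat x (Y x)) (hat x (Z x)) (hat x (S x *m v)).
Proof.
move=> hX hY hZ.
have sphi : msmooth U (phi a) by apply: msmooth_sub UD _; exact: spinor_smooth hphi a.
have dphi := is_mderiv v oU Ux sphi.
have xx : chart_inv x (chart x x) = x by rewrite chartK//; exact: chart_dom_mem.
have [_ E] := is_derive_three_form c dphi
  (is_derive_frame_coord hX) (is_derive_frame_coord hY)
  (is_derive_frame_coord hZ).
move: E; rewrite [LHS](_ : _ = mderiv (fun y => spinor_form y (X y) (Y y) (Z y)) x v)//.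
move=> ->; rewrite /= xx mderiv_phi /spinor_form.
have := three_form_so7 hc (phi a x) (hat x (X x)) (hat x (Y x)) (hat x (Z x))
  conn_form_so7.
rewrite three_formB1 three_formB2 three_formB3 /four_form !(mulmxBr, dot_linear); lra.
Qed.

End At.
End SpinFrame.

(** * The intrinsic torsion and its divergence *)

Section Harmonic.
Context (R : realType) (c : {linear 'cV[R]_7 -> 'M[R]_8}) (hc : clifford_module c).
Context (M : manifold R) (g : metric M) (Q : spin_structure c g).
Context (nabla : cov_deriv M) (hnabla : levi_civita g nabla).
Context (phi : spinor_components Q) (hphi : unit_spinor_field phi).
Context (phi0 : 'cV[R]_8) (hphi0 : dot phi0 phi0 = 1).
Context (nablaG : cov_deriv M) (hnablaG : g2_connection phi0 nabla phi nablaG).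
Context (xi : tensor12 M) (hxi : intrinsic_torsion nabla nablaG xi).
Context (S : M -> 'M[R]_7) (hS : endo_field S) (hSphi : spinor_endo nabla phi S).
Context (a : spin_idx Q).
Local Notation D := (spin_dom a).
Local Notation f := (spin_frame a).
Local Notation e := (basis7 R).
Local Notation hat := (frame_coord a).
Local Notation tform := (spinor_form phi a).
Implicit Types (U : set M) (x y : M) (v w X Y Z : 'cV[R]_7).

(** A smooth local map into Spin(7) that moves [phi0] to [phi]. Fix
    [psi = e_0 . phi(x)] and an element of Spin(7) moving [phi0] to [psi]. Near
    [x] the spinor [phi(y)] has the component [X(y) . psi] with [X_0(y)]
    non-zero, and [F = X_0 e_1 - X_1 e_0] is orthogonal to [X] and non-zero, so
    that [F . psi] is orthogonal to [phi(y)] and [two_vectors_act] applies. The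
    rotation covered is a product of reflections and as such rational in
    [phi(y)]. *)
Lemma local_g2_lift x : D x -> exists U (A : M -> 'M[R]_7),
  [/\ open U, U x, U `<=` D, msmooth U A &
    forall y, U y -> exists2 h, spin_covers c h (A y) & phi a y = h *m phi0].
Proof.
move=> Dx; have oD := spin_dom_open a.
have u1 y : D y -> dot (phi a y) (phi a y) = 1 by exact: spinor_unit hphi a y.
have sphi := spinor_smooth hphi a.
pose psi := c (e 0) *m phi a x.
have ee i j : dot (e i) (e j) = (i == j)%:R by rewrite dot_basisl mxE eqxx andbT.
have psi1 : dot psi psi = 1 by rewrite cl_dot// ee eqxx u1// mulr1.
have [h0 [A0 [hA0 h0psi]]] := spin7_transitive hc hphi0 psi1.
pose X y := spinor_vec c psi (phi a y).
(* F is a fixed skew matrix applied to X, hence orthogonal to X, and it is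
   smooth and non-zero where X_0 is: at x itself, X = - e_0. *)
pose F y : 'cV[R]_7 := X y 0 0 *: e 1 - X y 1 0 *: e 0.
pose W y := spinor_vec c (c (F y) *m psi) (phi a y).
have sX i : msmooth D (fun y => X y i 0).
  have := msmooth_dot oD sphi (msmooth_cst (c (e i) *m psi) oD).
  by apply: msmooth_eq => // y _; rewrite mxE.
have sF : msmooth D F.
  have -> : F = fun y => X y 0 0 *: e 1 + (- 1 * X y 1 0) *: e 0.
    by apply/funext => y; rewrite mulN1r scaleNr.
  apply: msmooth_add => //; apply: msmooth_scale => //; try exact: msmooth_cst.
  by apply: msmooth_mul => //; exact: msmooth_cst.
have sW : msmooth D W.
  apply/msmooth_mxP => // i j; rewrite (ord1 j).
  have sc : msmooth D (fun y => c (e i) *m (c (F y) *m psi)).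
    apply: msmooth_mulmx => //; first exact: msmooth_cst.
    by apply: msmooth_mulmx => //; [exact: msmooth_linear | exact: msmooth_cst].
  by apply: msmooth_eq (msmooth_dot oD sphi sc) => // y _; rewrite mxE.
pose U := D `&` [set y | X y 0 0 != 0].
have oU : open U by exact: open_neq0.
have UD : U `<=` D by move=> y [].
have F0 y : U y -> F y != 0.
  move=> [_ X0]; apply: contra_neq X0 => /(congr1 (fun u => dot u (e 1))).
  by rewrite !dot_linear !ee /= mulr1 mulr0 subr0.
have orthF y : dot (phi a y) (c (F y) *m psi) = 0.
  by rewrite -spinor_vecP -/(X y) !dot_linear !dot_basisr mulrC subrr.
have pairs y (Uy : U y) := two_vectors_act hc psi1 (u1 _ (UD _ Uy)) (F0 _ Uy) (orthF y).
exists U, (fun y => (reflection (W y) *m reflection (F y)) *m A0); split => //.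
- split=> //=; rewrite mxE cl_sqr// ee eqxx scaleN1r dotNr u1//.
- apply: msmooth_mulmx => //; last exact: msmooth_cst.
  apply: msmooth_mulmx => //; apply: msmooth_reflection => //.
  + by move=> y Uy; have [] := pairs y Uy.
  + exact: msmooth_sub sW.
  + exact: msmooth_sub sF.
- move=> y Uy; have [_ [h hh hpsi]] := pairs y Uy.
  by exists (h *m h0); [exact: spin_covers_mul | rewrite -mulmxA h0psi].
Qed.

(** In a local section [E = f A] of the G2-reduction the 3-form has the constant
    components of the 3-form of [phi0]. The derivative of these components
    vanishes, which by [mderiv_spinor_form] is the equation that determines the
    [m]-part [C] of the connection form; the torsion is [- C] in the frame [E]. *)
Lemma torsion_spinor_endo x v w Z : D x ->
  g x (xi x v w) Z = 2 / 3 * tform x Z w (S x *m v).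
Proof.
move=> Dx; have [U [A [oU Ux UD sA hA]]] := local_g2_lift Dx.
pose E y := f y *m A y.
have vE j : vfield U (fr E j).
  have := vfield_sum (index_enum 'I_7) (a := fun i y => A y i j) (X := fr f) oU
    (fun i => (msmooth_mxP A oU).1 sA i j) (fun i => vfield_fr (a := a) i UD).
  apply: vfield_eq => // y _; rewrite /fr /E [RHS]colE -mulmxA -colE.
  rewrite {1}(basis7_dec (col j (A y))) mulmx_sumr; apply: eq_bigr => i _.
  by rewrite mxE -scalemxAr -colE.
have secE : g2_section phi0 phi U E.
  split=> // y Uy; have [h hh hphiy] := hA y Uy.
  by exists a, h, (A y); split => //; exact: UD.
have [h hh phix] := hA x Ux.
have hatE y u : U y -> hat y (E y *m u) = A y *m u.
  by move=> Uy; rewrite -mulmxA frame_coord_mul//; exact: UD.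
have Adot X Y : dot (A x *m X) (A x *m Y) = dot X Y by exact: covers_dot hh.
have AK : A x *m (A x)^T = 1%:M.
  apply: mulmx1C; apply/matrixP => i j.
  have := Adot (e i) (e j); rewrite dot_mulmx !dot_basisl mulmxA -colE mxE => ->.
  by rewrite !mxE eqxx andbT.
have AtK (u : 'cV[R]_7) : A x *m ((A x)^T *m u) = u by rewrite mulmxA AK mul1mx.
pose om := conn_form g nabla E x v.
pose s := (A x)^T *m hat x (S x *m v).
have hat_inj u u' : hat x u = hat x u' -> u = u'.
  by move=> uu; rewrite -(frame_coordK u Dx) uu frame_coordK.
have frE j : fr E j x = E x *m e j by rewrite /fr colE.
have nablaE j : nabla x v (fr E j) = E x *m (om *m e j).
  apply: hat_inj; rewrite hatE// -[LHS]AtK; congr (_ *m _).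
  apply/colP => i; rewrite -colE [RHS]mxE [RHS]mxE (g_frame_coord (a := a))// frE hatE//.
  by rewrite dotC dot_mulmx dot_basisl.
have fieldE u : (fun y => E y *m u) = fun y => \sum_j u j 0 *: fr E j y.
  apply/funext => y; rewrite {1}(basis7_dec u) mulmx_sumr; apply: eq_bigr => j _.
  by rewrite -scalemxAr /fr colE.
have vfE u : vfield U (fun y => E y *m u).
  rewrite fieldE; apply: (vfield_sum _ (a := fun j _ => u j 0)) => // j.
  exact: msmooth_cst.
have lin (N : 'M[R]_7) (u : 'cV[R]_7) :
    \sum_j u j 0 *: (E x *m (N *m e j)) = E x *m (N *m u).
  rewrite [in RHS](basis7_dec u) !mulmx_sumr; apply: eq_bigr => j _.
  by rewrite -!scalemxAr.
have nablaEu (u : 'cV[R]_7) : nabla x v (fun y => E y *m u) = E x *m (om *m u).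
  rewrite fieldE (connection_sum v _ _ (lc_connection hnabla) oU Ux)// -lin.
  by apply: eq_bigr => j _; rewrite nablaE.
have [B [hB hC] hG] := hnablaG.2 U E x v oU secE Ux.
have nablaGEu (u : 'cV[R]_7) : nablaG x v (fun y => E y *m u) = E x *m (B *m u).
  rewrite fieldE (connection_sum v _ _ hnablaG.1 oU Ux)// -lin.
  apply: eq_bigr => j _; rewrite hG; congr (_ *: _).
  rewrite [in RHS](basis7_dec (B *m e j)) mulmx_sumr; apply: eq_bigr => i _.
  by rewrite frE -scalemxAr -[B *m e j]colE mxE.
set C := conn_form g nabla E x v - B in hC.
have omE : om = B + C by rewrite /C addrC subrK.
have key X Y Z' : three_form c phi0 ((B + C) *m X) Y Z'
     + three_form c phi0 X ((B + C) *m Y) Z'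
     + three_form c phi0 X Y ((B + C) *m Z') + four_form c phi0 X Y Z' s = 0.
  have := mderiv_spinor_form hc hnabla hphi hSphi oU UD Ux v (vfE X) (vfE Y) (vfE Z').
  rewrite (mderiv_eq (g := fun=> (three_form c phi0 X Y Z' : R)) v oU Ux); last first.
    move=> y Uy; have [h' hh' phiy] := hA y Uy.
    by rewrite /spinor_form !hatE// phiy (covers_three_form hc _ _ _ _ hh').
  rewrite mderiv_const !nablaEu /spinor_form !hatE// phix -(AtK (hat x (S x *m v))).
  by rewrite !(covers_three_form hc _ _ _ _ hh) (covers_four_form hc _ _ _ _ _ hh) -omE.
have CE := m_g2_of_three_form_derivative hc hphi0 hB hC key.
pose u := (A x)^T *m hat x w; pose z := (A x)^T *m hat x Z.
have wE : w = E x *m u by apply: hat_inj; rewrite hatE// AtK.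
have Cdot : dot z (C *m u) = - (2 / 3) * three_form c phi0 z u s.
  rewrite three_form_sum1 mulr_sumr; apply: eq_bigr => i _.
  rewrite [(C *m u) i 0]mxE three_form_sum2 !mulr_sumr; apply: eq_bigr => j _.
  by rewrite CE; ring.
have -> : tform x Z w (S x *m v) = three_form c phi0 z u s.
  rewrite /spinor_form phix -(AtK (hat x Z)) -(AtK (hat x w)) -(AtK (hat x (S x *m v))).
  by rewrite (covers_three_form hc _ _ _ _ hh).
rewrite wE (hxi v oU (vfE u) Ux) nablaGEu nablaEu omE -mulmxBr -mulmxBl.
rewrite (g_frame_coord (a := a))//.
rewrite hatE// -(AtK (hat x Z)) -/z Adot opprD addNKr mulNmx dotNl dotC Cdot; ring.
Qed.

(** The Leibniz rule for [2/3 T(Z, Y, S X)], in which the terms with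
    derivatives of [Y] and [Z] cancel against those of [nabla xi]. *)
Lemma cov_tensor_torsion U x v (X Y Z : M -> 'cV[R]_7) : open U -> U `<=` D -> U x ->
  vfield U X -> vfield U Y -> vfield U Z ->
  g x (cov_tensor nabla xi x v X Y) (Z x) =
  2 / 3 * (tform x (Z x) (Y x) (nabla x v (fun y => S y *m X y) - S x *m nabla x v X)
    + four_form c (phi a x) (hat x (Z x)) (hat x (Y x)) (hat x (S x *m X x))
        (hat x (S x *m v))).
Proof.
move=> oU UD Ux hX hY hZ; have Dx := UD x Ux.
have vS : vfield U (fun y => S y *m X y) by exact: hS.
(* As a difference of two covariant derivatives, xi_X Y is a vector field, so
   that nabla may be applied to it. *)
pose L y := xi y (X y) (Y y).
have vL : vfield U L.
  have v1 := nabla_smooth hnablaG.1 oU hX hY.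
  have v2 := nabla_smooth (lc_connection hnabla) oU hX hY.
  have := vfield_sum [:: true; false] (a := fun b _ => if b then 1 else -1)
    (X := fun b y => if b then nablaG y (X y) Y else nabla y (X y) Y) oU
    (fun b => msmooth_cst _ oU).
  have h (b : bool) :
      vfield U (fun y => if b then nablaG y (X y) Y else nabla y (X y) Y).
    by case: b.
  move/(_ h); apply: vfield_eq => // y Uy.
  by rewrite big_cons big_seq1 scale1r scaleN1r /L (hxi _ oU hY Uy).
have gD y u u' w : g y (u - u') w = g y u w - g y u' w.
  by rewrite addrC -scaleN1r g_lin mulN1r addrC.
have E1 := lc_metric hnabla v oU vL hZ Ux.
have E2 := mderiv_spinor_form hc hnabla hphi hSphi oU UD Ux v hZ hY vS.
have E3 : mderiv (fun y => tform y (Z y) (Y y) (S y *m X y)) x v =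
    3 / 2 * mderiv (fun y => g y (L y) (Z y)) x v.
  rewrite (mderiv_eq (g := fun y => 3 / 2 * g y (L y) (Z y) : R) v oU Ux).
    have := is_derive_mul (is_derive_const (3 / 2 : R) _ _)
      (is_mderiv v oU Ux (g_smooth g oU vL hZ)).
    by rewrite mul0r add0r => -[_ <-].
  by move=> y Uy; rewrite torsion_spinor_endo; [field | exact: UD].
rewrite /cov_tensor !gD -/(L _) !torsion_spinor_endo//.
rewrite E2 E1 torsion_spinor_endo// in E3.
rewrite /spinor_form in E2 E3 *; rewrite frame_coordB three_formB3; lra.
Qed.

End Harmonic.

Theorem theorem4p2 (R : realType)
    (c : {linear 'cV[R]_7 -> 'M[R]_8}) (hc : clifford_module c)
    (M : manifold R) (g : metric M) (Q : spin_structure c g)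
    (nabla : cov_deriv M) (hnabla : levi_civita g nabla)
    (phi : spinor_components Q) (hphi : unit_spinor_field phi)
    (phi0 : 'cV[R]_8) (hphi0 : dot phi0 phi0 = 1)
    (nablaG : cov_deriv M) (hnablaG : g2_connection phi0 nabla phi nablaG)
    (xi : tensor12 M) (hxi : intrinsic_torsion nabla nablaG xi)
    (S : M -> 'M[R]_7) (hS : endo_field S) (hSphi : spinor_endo nabla phi S) :
  harmonic_g2 g nabla xi <-> div_free g nabla S.
Proof.
(* <L Y, Z> = 2/3 T(Z, Y, div S), for any smooth frame in place of e_1, ..., e_7 *)
have contracted a U frm Y Z x : open U -> U `<=` spin_dom a -> U x ->
    smooth_frame U frm -> vfield U Y -> vfield U Z ->
    g x (\sum_i cov_tensor nabla xi x (fr frm i x) (fr frm i) Y) (Z x) =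
    2 / 3 * three_form c (phi a x) (frame_coord a x (Z x)) (frame_coord a x (Y x))
       (frame_coord a x (divergence nabla S frm x)).
  move=> oU UD Ux hF hY hZ; rewrite g_suml /divergence frame_coord_sum.
  rewrite {1}/three_form linear_sum mulmx_suml dot_sumr mulr_sumr.
  apply: eq_bigr => i _.
  rewrite (cov_tensor_torsion hc hnabla hphi hphi0 hnablaG hxi hS hSphi _
    oU UD Ux (hF i) hY hZ).
  by rewrite four_form_alt// addr0.
have restrict U U' (frm : M -> 'M[R]_7) : U' `<=` U -> smooth_frame U frm ->
    smooth_frame U' frm.
  by move=> UU h j; exact: vfield_sub UU (h j).
split=> h U frm.
  move=> x oU [hF hO] Ux; have [a Da] := spin_dom_cover Q x.
  pose U' := U `&` spin_dom a.
  have oU' : open U' by apply: openI => //; exact: spin_dom_open.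
  have UD : U' `<=` spin_dom a by move=> y [].
  have UU : U' `<=` U by move=> y [].
  have Ux' : U' x by [].
  have hF' := restrict _ _ _ UU hF.
  have hfr i : vfield U' (fr (spin_frame a) i) by exact: vfield_fr.
  suff d0 : frame_coord a x (divergence nabla S frm x) = 0.
    by rewrite -(frame_coordK (a := a) (divergence nabla S frm x) Da) d0 mulmx0.
  (* As Y and Z run through the spin frame, T(Z, Y, div S) = 0 for all arguments. *)
  apply: (three_form_nondeg hc (spinor_unit hphi Da)) => X Y.
  rewrite three_form_sum1 big1 // => k _; rewrite three_form_sum2 big1 ?mulr0 // => j _.
  have := contracted a U' frm _ _ x oU' UD Ux' hF' (hfr j) (hfr k).
  rewrite (h U' frm _ x oU' _ (hfr j) Ux').
    rewrite !frame_coord_fr// -(scale0r 0) g_scalel mul0r => hh.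
    by rewrite (_ : three_form _ _ _ _ _ = 0) ?mulr0//; lra.
  by split=> // y Uy; apply: hO; exact: UU.
move=> Y x oU [hF hO] hY Ux; have [a Da] := spin_dom_cover Q x.
pose U' := U `&` spin_dom a.
have oU' : open U' by apply: openI => //; exact: spin_dom_open.
have UD : U' `<=` spin_dom a by move=> y [].
have UU : U' `<=` U by move=> y [].
have Ux' : U' x by [].
have hF' := restrict _ _ _ UU hF.
have hfr i : vfield U' (fr (spin_frame a) i) by exact: vfield_fr.
set L := \sum_i _; suff d0 : frame_coord a x L = 0.
  by rewrite -(frame_coordK (a := a) L Da) d0 mulmx0.
apply/colP => k; rewrite [RHS]mxE -g_fr//.
rewrite (contracted a U' frm Y _ x oU' UD Ux' hF' (vfield_sub UU hY) (hfr k)).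
by rewrite (h U frm x oU (conj hF hO) Ux) /frame_coord mulmx0 /three_form cl0l dot0r mulr0.
Qed.
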